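(* The Hodge filtration $\mathcal{F}_{H}:\mathrm{Mod}_{\mathcal{O}_K^\flat,f}^{\varphi}\rightarrow\mathrm{Fil}_{\mathbb{F}}^{\mathbb{R}}$ is compatible with tensor products, duals, symmetric and exterior powers. For every exact sequence \[ 0\rightarrow(M_{1},\varphi_{1})\rightarrow(M_{2},\varphi_{2})\rightarrow(M_{3},\varphi_{3})\rightarrow0 \] in $\mathrm{Mod}_{\mathcal{O}_K^\flat,f}^{\varphi}$ with $r_{i}=\mathrm{rank}\, M_{i}$ (so that $r_{2}=r_{1}+r_{3}$), we have \[ t_{H}(M_{1},\varphi_{1})\ast t_{H}(M_{3},\varphi_{3})\leq t_{H}(M_{2},\varphi_{2})\quad\text{in}\quad\mathbb{R}_{\geq}^{r_{2}} \] with equality if and only if for every $\gamma\in\mathbb{R}$, the complex of $\mathbb{F}$-vector spaces \[ 0\rightarrow\mathcal{F}_{H}^{\gamma}(M_{1},\varphi_{1})\rightarrow\mathcal{F}_{H}^{\gamma}(M_{2},\varphi_{2})\rightarrow\mathcal{F}_{H}^{\gamma}(M_{3},\varphi_{3})\rightarrow0 \] is exact.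
   Context: $K$ is a perfectoid field extension of a finite extension $E$ of $\mathbb{Q}_p$ with residue field $\mathbb{F}_q$ and uniformizer $\pi$, $K^\flat$ its tilt with valuation ring $\mathcal{O}_K^\flat$, maximal ideal $\mathfrak{m}_K^\flat$ and residue field $\mathbb{F}$; $\varphi(x)=x^q$. The absolute value of $K^\flat$ is normalized by $q|\varpi^q|=1$, where $\varpi\in\mathcal{O}_K^\flat$ is the reduction mod $\pi$ of a generator of $\ker(\theta:W_{\mathcal{O}_E}(\mathcal{O}_K^\flat)\twoheadrightarrow\mathcal{O}_K)$. $\mathrm{Mod}_{\mathcal{O}_K^\flat,f}^{\varphi}$ is the category of finite free $\mathcal{O}_K^\flat$-modules $M$ equipped with a $K^\flat$-linear isomorphism $\varphi_M:(\varphi^*M)\otimes K^\flat\to M\otimes K^\flat$; short exact sequences are those which are exact on underlying modules; tensor constructions are the obvious ones (e.g. $(M_1\otimes M_2,\varphi_1\otimes\varphi_2)$, $(M^\vee,(\varphi_M^{\vee})^{-1})$). $\mathrm{Fil}^{\mathbb{R}}_{\mathbb{F}}$ is the category of finite dimensional $\mathbb{F}$-vector spaces with an $\mathbb{R}$-filtration (decreasing, exhaustive, separated, left-continuous), with its usual tensor product $\mathcal{F}^\gamma(V_1\otimes V_2)=\sum_{\gamma_1+\gamma_2=\gamma}\mathcal{F}^{\gamma_1}(V_1)\otimes\mathcal{F}^{\gamma_2}(V_2)$, duals ($\mathcal{F}^\gamma(V^\vee)=$ annihilator of $\mathcal{F}^{>-\gamma}(V)$), symmetric and exterior powers (image filtrations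 from $V^{\otimes k}$). The Hodge filtration $\mathcal{F}_H(M,\varphi_M)$ is the $\mathbb{R}$-filtration on $M\otimes\mathbb{F}=M/\mathfrak{m}_K^\flat M$ given, with $M'=\varphi_M(\varphi^*M)\subset M\otimes K^\flat$ and $I(\gamma)=\{x\in K^\flat:|x|\le q^{-\gamma}\}$, by $\mathcal{F}_H^\gamma=\big(M\cap I(\gamma)M'+\mathfrak{m}_K^\flat M\big)/\mathfrak{m}_K^\flat M$. Its type $t_H(M,\varphi_M)\in\mathbb{R}^r_\ge=\{(\gamma_1\ge\dots\ge\gamma_r)\}$, $r=\mathrm{rank}\,M$, contains $\gamma$ with multiplicity $\dim_{\mathbb{F}}\mathcal{F}_H^{\ge\gamma}/\mathcal{F}_H^{>\gamma}$; equivalently $t_H=(\log_q|x_1|\ge\dots\ge\log_q|x_r|)$ if $(e_i)$ is a basis of $M$ with $(x_ie_i)$ a basis of $M'$. On $\mathbb{R}^r_\ge$: $(\gamma_i)\le(\gamma_i')$ iff $\gamma_1+\dots+\gamma_s\le\gamma'_1+\dots+\gamma'_s$ for all $s\le r$ with equality for $s=r$. $\ast:\mathbb{R}^{r_1}_\ge\times\mathbb{R}^{r_3}_\ge\to\mathbb{R}^{r_1+r_3}_\ge$ concatenates and reorders. *)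

(* Defs.v *)
From HB Require Import structures.
From mathcomp Require Import all_boot all_order all_algebra.
From mathcomp Require Import fingroup perm pgroup abelian fieldext sesquilinear.
From mathcomp Require Import boolp classical_sets reals topology normedtype.
From mathcomp Require Import sequences exp.

Set Implicit Arguments.
Unset Strict Implicit.
Unset Printing Implicit Defensive.

Import Order.TTheory GRing.Theory Num.Theory.
Import VectorInternalTheory numFieldNormedType.Exports.

Local Open Scope classical_set_scope.
Local Open Scope ring_scope.

Record absval (R : realType) (F : fieldType) := AbsVal {
  abs_fun :> F -> R;
  abs_ge0 : forall x, 0 <= abs_fun x;
  abs_eq0 : forall x, (abs_fun x == 0) = (x == 0);
  absM : forall x y, abs_fun (x * y) = abs_fun x * abs_fun y;
  abs_ultra : forall x y, abs_fun (x + y) <= Num.max (abs_fun x) (abs_fun y)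
}.

Section AbsvalTheory.
Variables (R : realType) (F : fieldType) (v : absval R F).

Lemma abs0 : v 0 = 0. Proof. by apply/eqP; rewrite abs_eq0. Qed.

Lemma abs1 : v 1 = 1.
Proof.
apply: (@mulfI _ (v 1)); first by rewrite abs_eq0 oner_eq0.
by rewrite -absM !mulr1.
Qed.

Lemma absX x n : v (x ^+ n) = v x ^+ n.
Proof. by elim: n => [|n IHn]; rewrite ?abs1 // !exprS absM IHn. Qed.

Lemma absN x : v (- x) = v x.
Proof.
suff h : v (-1) = 1 by rewrite -mulN1r absM h mul1r.
apply/eqP; rewrite -(@eqrXn2 _ 2) ?abs_ge0 ?ler01 //.
by rewrite -absX sqrrN !expr1n abs1.
Qed.

Lemma abs_distC x y : v (x - y) = v (y - x).
Proof. by rewrite -absN opprB. Qed.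

Lemma abs_le_max x y c : v x <= c -> v y <= c -> v (x + y) <= c.
Proof. by move=> hx hy; apply: le_trans (abs_ultra v x y) _; rewrite ge_max hx hy. Qed.

Definition abs_cvg (u : nat -> F) (l : F) : Prop :=
  forall e, 0 < e -> exists N, forall n, (N <= n)%N -> v (u n - l) < e.

Definition abs_cauchy (u : nat -> F) : Prop :=
  forall e, 0 < e ->
    exists N, forall m n, (N <= m)%N -> (N <= n)%N -> v (u m - u n) < e.

Definition abs_complete : Prop :=
  forall u, abs_cauchy u -> exists l, abs_cvg u l.

Lemma abs_cvg_le u l c : abs_cvg u l -> 0 <= c ->
  (forall n, v (u n) <= c) -> v l <= c.
Proof.
move=> ul c0 uc; rewrite leNgt; apply/negP => cl.
have [N /(_ N (leqnn N)) h] := ul _ (le_lt_trans c0 cl).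
have : v l <= Num.max (v (l - u N)) (v (u N)).
  by rewrite -{1}(subrK (u N) l); exact: abs_ultra.
rewrite abs_distC => /le_lt_trans /(_ (_ : _ < v l)).
rewrite gt_max h (le_lt_trans (uc N) cl) => /(_ isT).
by rewrite ltxx.
Qed.

Definition vring_pred : {pred F} := fun x => v x <= 1.

Fact vring_pred_closed : subring_closed vring_pred.
Proof.
split=> [|x y|x y]; rewrite /vring_pred /in_mem /= ?abs1 ?lexx //.
- by move=> hx hy; apply: abs_le_max => //; rewrite absN.
- by move=> hx hy; rewrite absM mulr_ile1 ?abs_ge0.
Qed.

HB.instance Definition _ := GRing.isSubringClosed.Build F vring_pred
  vring_pred_closed.

Record vring := VRing { vr_val : F; _ : vr_val \in vring_pred }.
HB.instance Definition _ := [isSub for vr_val].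
HB.instance Definition _ := [Choice of vring by <:].
HB.instance Definition _ := [SubChoice_isSubComNzRing of vring by <:].

Lemma vring_le1 (x : vring) : v (vr_val x) <= 1.
Proof. exact: (valP x). Qed.

Definition is_residue_map (k : fieldType) (res : {rmorphism vring -> k}) : Prop :=
  (forall y, exists x, res x = y) /\
  (forall x, res x = 0 <-> v (vr_val x) < 1).

End AbsvalTheory.



HB.instance Definition _ (R : realType) (F : fieldType) (v : absval R F) :=
  GRing.RMorphism.copy (@vr_val R F v) (\val : vring v -> F).

(* The field Q_p: a complete valued field in which Q is dense and |p| < 1.  The
   value |p| is not fixed; it is pinned down at the end by the normalization of
   the absolute value of the tilt. *)
Record padic_numbers (R : realType) (p : nat) := PadicNumbers {
  Qp_field :> fieldType;
  Qp_abs : absval R Qp_field;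
  Qp_prime : prime p;
  Qp_abs_p : 0 < Qp_abs p%:R < 1;
  Qp_complete : abs_complete Qp_abs;
  Qp_dense : forall x e, 0 < e -> exists r : rat, Qp_abs (x - ratr r) < e
}.

(* A finite extension E of Q_p, given with a uniformizer and its residue field
   F_q. *)
Record padic_field (R : realType) (p : nat) := PadicField {
  pf_Qp : padic_numbers R p;
  pf_field :> fieldExtType pf_Qp;
  pf_abs : absval R pf_field;
  pf_abs_ext : forall x : pf_Qp, pf_abs x%:A = Qp_abs pf_Qp x;
  pf_unif : vring pf_abs;
  pf_unifP : forall x : vring pf_abs,
    pf_abs (vr_val x) < 1 <-> exists y, x = pf_unif * y;
  pf_res : finFieldType;
  pf_res_map : {rmorphism vring pf_abs -> pf_res};
  pf_resP : is_residue_map pf_res_map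
}.

Definition pf_q (R : realType) (p : nat) (E : padic_field R p) : nat :=
  #|pf_res E|.

Record perfectoid_ext (R : realType) (p : nat) (E : padic_field R p) :=
  PerfectoidExt {
  pe_field :> fieldType;
  pe_of : {rmorphism E -> pe_field};
  pe_abs : absval R pe_field;
  pe_abs_ext : forall x : E, pe_abs (pe_of x) = pf_abs E x;
  pe_complete : abs_complete pe_abs;
  pe_nondiscrete : forall x, pe_abs x < 1 -> exists y, pe_abs x < pe_abs y < 1;
  pe_frobenius : forall x, pe_abs x <= 1 ->
    exists2 y, pe_abs y <= 1 & pe_abs (x - y ^+ p) <= pe_abs p%:R
}.

(* The tilt of K: a field whose elements are the sequences (x^(n)) of K with
   (x^(n+1))^p = x^(n), multiplied termwise and added by
   (x + y)^(n) = lim_k (x^(n+k) + y^(n+k))^(p^k). *)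
Record tilt (R : realType) (p : nat) (E : padic_field R p)
    (K : perfectoid_ext E) := Tilt {
  tl_field :> fieldType;
  tl_coord : tl_field -> nat -> K;
  tl_compat : forall x n, tl_coord x n.+1 ^+ p = tl_coord x n;
  tl_inj : forall x y, tl_coord x =1 tl_coord y -> x = y;
  tl_surj : forall u : nat -> K, (forall n, u n.+1 ^+ p = u n) ->
    exists x, tl_coord x =1 u;
  tl_M : forall x y n, tl_coord (x * y) n = tl_coord x n * tl_coord y n;
  tl_D : forall x y n, abs_cvg (pe_abs K)
    (fun k => (tl_coord x (n + k)%N + tl_coord y (n + k)%N) ^+ (p ^ k))
    (tl_coord (x + y) n)
}.

Section TiltTheory.
Variables (R : realType) (p : nat) (E : padic_field R p).
Variables (K : perfectoid_ext E) (T : tilt K).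

Local Notation absK := (pe_abs K).
Local Notation coord := (@tl_coord R p E K T).

Definition tl_sharp (x : T) : K := coord x 0%N.

Lemma pf_prime : prime p. Proof. exact: Qp_prime (pf_Qp E). Qed.

Lemma pf_abs_p : 0 < pf_abs E p%:R < 1.
Proof.
have -> : p%:R = (p%:R)%:A :> E by rewrite scaler_nat.
by rewrite pf_abs_ext; exact: Qp_abs_p.
Qed.

Lemma pe_abs_p : 0 < absK p%:R < 1.
Proof. by rewrite -(rmorph_nat (pe_of K)) pe_abs_ext; exact: pf_abs_p. Qed.

Lemma tl_compatX x n k : coord x (n + k)%N ^+ (p ^ k) = coord x n.
Proof.
elim: k => [|k IHk]; first by rewrite addn0 expr1.
by rewrite addnS expnS exprM tl_compat.
Qed.

Lemma tl_coord0 n : coord 0 n = 0.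
Proof.
have [z zE] : exists z, coord z =1 fun=> 0.
  by apply: tl_surj => m; rewrite expr0n eqn0Ngt prime_gt0 // pf_prime.
suff <- : z = 0 by [].
by rewrite -(mulr0 z); apply: tl_inj => m; rewrite tl_M !zE mul0r.
Qed.

Lemma tl_coord1 n : coord 1 n = 1.
Proof.
have [z zE] : exists z, coord z =1 fun=> 1.
  by apply: tl_surj => m; rewrite expr1n.
suff <- : z = 1 by [].
by rewrite -(mulr1 z); apply: tl_inj => m; rewrite tl_M !zE mul1r.
Qed.

Lemma tl_abs_coord x n : absK (coord x n) ^+ (p ^ n) = absK (tl_sharp x).
Proof. by rewrite -absX -{1}[n]add0n tl_compatX. Qed.

Fact tl_abs_ge0 x : 0 <= absK (tl_sharp x). Proof. exact: abs_ge0. Qed.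

Fact tl_abs_eq0 x : (absK (tl_sharp x) == 0) = (x == 0).
Proof.
apply/eqP/eqP => [x0|->]; last by rewrite /tl_sharp tl_coord0 abs0.
apply: tl_inj => n; rewrite tl_coord0; apply/eqP.
rewrite -(abs_eq0 absK).
have /eqP := tl_abs_coord x n; rewrite x0 expf_eq0.
by case/andP.
Qed.

Fact tl_absM x y : absK (tl_sharp (x * y)) = absK (tl_sharp x) * absK (tl_sharp y).
Proof. by rewrite /tl_sharp tl_M absM. Qed.

Fact tl_abs_ultra x y :
  absK (tl_sharp (x + y)) <= Num.max (absK (tl_sharp x)) (absK (tl_sharp y)).
Proof.
apply: (abs_cvg_le (tl_D x y 0)) => [|k]; first by rewrite le_max abs_ge0.
rewrite add0n absX -(tl_abs_coord x k) -(tl_abs_coord y k).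
have := abs_ultra absK (coord x k) (coord y k).
rewrite !le_max => /orP[] h; apply/orP; [left|right];
  by rewrite lerXn2r // nnegrE abs_ge0.
Qed.

(* The absolute value of the tilt is |x| = |x^sharp|; its scale is that of K. *)
Definition tl_abs : absval R T :=
  AbsVal tl_abs_ge0 tl_abs_eq0 tl_absM tl_abs_ultra.

Lemma pe_abs_nat n : absK n%:R <= 1.
Proof.
elim: n => [|n IHn]; first by rewrite abs0 ler01.
by rewrite -addn1 natrD abs_le_max ?abs1.
Qed.

Lemma pe_abs_modn m n : m = n %[mod p] -> absK (m%:R - n%:R) <= absK p%:R.
Proof.
have key a b : (a <= b)%N -> b = a %[mod p] -> absK (b%:R - a%:R) <= absK p%:R.
  move=> ab /eqP; rewrite eqn_mod_dvd // => /dvdnP[t tE].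
  by rewrite -natrB // tE natrM absM ler_piMl ?abs_ge0 ?pe_abs_nat.
by move=> mn; case: (leqP m n) => [/key h|/ltnW/key]; [rewrite abs_distC h|apply].
Qed.

Lemma tl_coord_nat N n : absK (coord N%:R n - N%:R) <= absK p%:R.
Proof.
elim: N n => [|N IHN] n.
  by rewrite tl_coord0 subrr abs0 abs_ge0.
have cvgN := tl_D (N%:R : T) 1 n.
have {}cvgN : abs_cvg absK
   (fun k => (coord N%:R (n + k)%N + coord 1 (n + k)%N) ^+ (p ^ k) - N.+1%:R)
   (coord N.+1%:R n - N.+1%:R).
  rewrite -[in coord _ _]addn1 natrD => e e0; have [M hM] := cvgN e e0.
  exists M => m Mm; apply: le_lt_trans (hM m Mm).
  by rewrite opprB addrA subrK lexx.
apply: (abs_cvg_le cvgN) => [|k]; first exact: abs_ge0.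
rewrite tl_coord1; set a := coord _ _.
have ha : absK (a - N%:R) <= absK p%:R by exact: IHN.
have a1 : absK a <= 1.
  rewrite -(subrK N%:R a) abs_le_max ?pe_abs_nat //.
  by apply: le_trans ha _; case/andP: pe_abs_p => _ /ltW.
have fermat : absK ((N.+1 ^ (p ^ k))%:R - N.+1%:R) <= absK p%:R.
  apply: pe_abs_modn; elim: k {a ha a1} => [|k IHk]; first by rewrite expn1.
  by rewrite expnSr expnM fermat_little // pf_prime.
rewrite -(subrK (N.+1 ^ (p ^ k))%:R (_ ^+ _)) -addrA abs_le_max //.
rewrite natrX subrXX absM.
apply: le_trans (_ : absK p%:R * 1 <= _); last by rewrite mulr1.
apply: ler_pM; rewrite ?abs_ge0 //.
  by rewrite -[N.+1]addn1 natrD opprD addrACA subrr addr0.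
have aN : absK (a + 1) <= 1 by rewrite abs_le_max // abs1.
elim/big_ind: _ => [|x y|i _]; rewrite ?abs0 ?ler01 //.
  exact: abs_le_max.
by rewrite absM !absX mulr_ile1 ?exprn_ge0 ?abs_ge0 ?exprn_ile1 ?abs_ge0 ?pe_abs_nat.
Qed.

Lemma tl_pchar : p \in [pchar T].
Proof.
rewrite inE pf_prime /= -tl_abs_eq0; apply/negPn/negP => c0.
have c_gt0 : 0 < absK (tl_sharp p%:R) by rewrite lt_def c0 abs_ge0.
have /andP[p0 p1] := pe_abs_p.
have hn n : absK (tl_sharp p%:R) <= absK p%:R ^+ n.
  rewrite -(tl_abs_coord _ n); apply: le_trans (_ : absK p%:R ^+ (p ^ n) <= _).
    rewrite lerXn2r ?nnegrE ?abs_ge0 // -(subrK p%:R (coord _ _)).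
    by rewrite abs_le_max // tl_coord_nat.
  by rewrite ler_wiXn2l ?abs_ge0 ?(ltW p1) // ltnW // ltn_expl // prime_gt1 // pf_prime.
have [N _ /(_ N (leqnn N))] : \forall n \near \oo, `|0 - absK p%:R ^+ n| < absK (tl_sharp p%:R).
  have : absK p%:R ^+ n @[n --> \oo] --> (0:R).
    by apply: cvg_expr; rewrite ger0_norm ?abs_ge0.
  by move/cvgrPdist_lt; apply.
rewrite /= sub0r normrN ger0_norm ?exprn_ge0 ?abs_ge0 //.
by rewrite ltNge hn.
Qed.

Lemma tl_vring_pchar : p \in [pchar vring tl_abs].
Proof.
rewrite inE pf_prime /=; apply/eqP/val_inj.
by rewrite -[LHS]/(vr_val _) rmorph_nat (pcharf0 tl_pchar).
Qed.

Lemma pf_res_pchar : p \in [pchar pf_res E].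
Proof.
rewrite inE pf_prime /= -(rmorph_nat (pf_res_map E)); apply/eqP/(pf_resP E).2.
by rewrite rmorph_nat; case/andP: pf_abs_p.
Qed.

Lemma pf_q_pnat : p.-nat (pf_q E).
Proof.
have := abelem_pgroup (fin_ring_pchar_abelem pf_res_pchar).
by rewrite /pgroup cardsT.
Qed.

Lemma tl_q_pnat : [pchar vring tl_abs].-nat (pf_q E).
Proof. by rewrite (eq_pnat _ (pcharf_eq tl_vring_pchar)) pf_q_pnat. Qed.


Definition tl_frob (x : vring tl_abs) : vring tl_abs := x ^+ pf_q E.

Fact tl_frob_nmod_morphism : nmod_morphism tl_frob.
Proof.
split=> [|x y]; last by rewrite /tl_frob exprDn_pchar // tl_q_pnat.
by rewrite /tl_frob expr0n eqn0Ngt; case/andP: pf_q_pnat => ->.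
Qed.

Fact tl_frob_monoid_morphism : monoid_morphism tl_frob.
Proof. by split=> [|x y]; rewrite /tl_frob ?expr1n ?exprMn. Qed.

HB.instance Definition _ := GRing.isNmodMorphism.Build _ _ tl_frob
  tl_frob_nmod_morphism.
HB.instance Definition _ := GRing.isMonoidMorphism.Build _ _ tl_frob
  tl_frob_monoid_morphism.

End TiltTheory.

(* The ramified Witt vectors W_{O_E}(O_K^flat), characterized as the
   pi-torsion-free, pi-adically separated and complete O_E-algebra with reduction
   O_K^flat modulo pi, with its Teichmueller lift and Fontaine's map theta. *)
Record ramified_witt (R : realType) (p : nat) (E : padic_field R p)
    (K : perfectoid_ext E) (T : tilt K) := RamifiedWitt {
  rw_ring :> comNzRingType;
  rw_of : {rmorphism vring (pf_abs E) -> rw_ring};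
  rw_red : {rmorphism rw_ring -> vring (tl_abs T)};
  rw_torsion_free : forall w, rw_of (pf_unif E) * w = 0 -> w = 0;
  rw_separated : forall w,
    (forall n, exists w', w = rw_of (pf_unif E) ^+ n * w') -> w = 0;
  rw_complete : forall u : nat -> rw_ring,
    (forall n, exists w', u n.+1 - u n = rw_of (pf_unif E) ^+ n * w') ->
    exists l, forall n, exists w', l - u n = rw_of (pf_unif E) ^+ n * w';
  rw_red_surj : forall x, exists w, rw_red w = x;
  rw_red_ker : forall w,
    rw_red w = 0 <-> exists w', w = rw_of (pf_unif E) * w';
  rw_teich : vring (tl_abs T) -> rw_ring;
  rw_teichK : forall x, rw_red (rw_teich x) = x;
  rw_teichM : forall x y, rw_teich (x * y) = rw_teich x * rw_teich y;
  rw_theta : {rmorphism rw_ring -> vring (pe_abs K)};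
  rw_theta_of : forall a, vr_val (rw_theta (rw_of a)) = pe_of K (vr_val a);
  rw_theta_teich : forall x,
    vr_val (rw_theta (rw_teich x)) = tl_sharp (vr_val x)
}.

Definition generates_ker_theta (R : realType) (p : nat) (E : padic_field R p)
    (K : perfectoid_ext E) (T : tilt K) (W : ramified_witt T) (xi : W) : Prop :=
  forall w, rw_theta W w = 0 <-> exists w', w = w' * xi.

(* q |varpi^q| = 1, where varpi is the reduction of a generator of ker theta *)
Definition normalized (R : realType) (p : nat) (E : padic_field R p)
    (K : perfectoid_ext E) (T : tilt K) (W : ramified_witt T) : Prop :=
  exists2 xi : W, generates_ker_theta xi &
    (pf_q E)%:R * tl_abs T (vr_val (rw_red W xi) ^+ pf_q E) = 1.

Record residue_field (R : realType) (L : fieldType) (v : absval R L) :=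
  ResidueField {
  rf_field :> fieldType;
  rf_map : {rmorphism vring v -> rf_field};
  rf_resP : is_residue_map rf_map
}.

(* Over a ring, [vectType] is the type of finite free modules, and [v2r], [r2v]
   are the coordinates in a fixed basis. *)

Section BaseChange.
Variables (R S : comNzRingType) (f : {rmorphism R -> S}).

Definition vb (M : vectType R) (i : 'I_(dim M)) : M := r2v (delta_mx 0 i).

Lemma vb_sum (M : vectType R) (x : M) :
  x = \sum_i (v2r x) 0 i *: vb i.
Proof.
apply: (can_inj v2rK); rewrite [in LHS](row_sum_delta (v2r x)) linear_sum /=.
by apply: eq_bigr => i _; rewrite linearZ /= r2vK.
Qed.

(* S (x)_{R, f} M, with [bc_in x] for 1 (x) x; as M is free it is a module of
   coordinate vectors. *)
Definition bc (f : {rmorphism R -> S}) (M : vectType R) : vectType S :=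
  'rV[S]_(dim M).

Definition bc_in (M : vectType R) (x : M) : bc f M := map_mx f (v2r x).

Definition bc_coord (M : vectType R) (u : bc f M) (i : 'I_(dim M)) : S :=
  (u : 'rV[S]_(dim M)) 0 i.

Lemma bc_coord_in (M : vectType R) (x : M) i :
  bc_coord (bc_in x) i = f ((v2r x) 0 i).
Proof. by rewrite /bc_coord mxE. Qed.

(* The S-linear, S-bilinear and S-multilinear extensions of R-(multi)linear
   maps *)

Definition bc_hom (M N : vectType R) (g : 'Hom(M, N)) : 'Hom(bc f M, bc f N) :=
  linfun (fun u : bc f M => \sum_i bc_coord u i *: bc_in (g (vb i))).

Definition bc_bil (M1 M2 N : vectType R) (b : M1 -> M2 -> N)
    (u : bc f M1) (v : bc f M2) : bc f N :=
  \sum_i \sum_j (bc_coord u i * bc_coord v j) *: bc_in (b (vb i) (vb j)).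

Definition bc_form (M1 M2 : vectType R) (b : M1 -> M2 -> R)
    (u : bc f M1) (v : bc f M2) : S :=
  \sum_i \sum_j bc_coord u i * bc_coord v j * f (b (vb i) (vb j)).

Definition bc_mul (k : nat) (M N : vectType R) (m : {ffun 'I_k -> M} -> N)
    (u : {ffun 'I_k -> bc f M}) : bc f N :=
  \sum_(a : {ffun 'I_k -> 'I_(dim M)})
    (\prod_i bc_coord (u i) (a i)) *: bc_in (m [ffun i => vb (a i)]).

Lemma bc_homE (M N : vectType R) (g : 'Hom(M, N)) (x : M) :
  bc_hom g (bc_in x) = bc_in (g x).
Proof.
pose h (u : bc f M) : bc f N := \sum_i bc_coord u i *: bc_in (g (vb i)).
have hlin : linear h.
  move=> a u v; rewrite /h scaler_sumr -big_split; apply: eq_bigr => i _ /=.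
  by rewrite /bc_coord !mxE scalerDl scalerA.
pose hL : {linear bc f M -> bc f N} :=
  HB.pack h (GRing.isLinear.Build S _ _ _ h hlin).
rewrite /bc_hom -/h -[h]/(hL : _ -> _) lfunE /= /h [in RHS](vb_sum x).
rewrite linear_sum /= /bc_in linear_sum /= raddf_sum; apply: eq_bigr => i _.
by rewrite bc_coord_in !linearZ /= map_mxZ.
Qed.

Lemma bc_bilE (M1 M2 N : vectType R) (b : {bilinear M1 -> M2 -> N}) x y :
  bc_bil b (bc_in x) (bc_in y) = bc_in (b x y).
Proof.
rewrite {2}(vb_sum x) linear_sumlz /bc_bil /bc_in linear_sum /= raddf_sum.
apply: eq_bigr => i _.
rewrite linearZl_LR {2}(vb_sum y) linear_sumr scaler_sumr linear_sum /= raddf_sum.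
apply: eq_bigr => j _.
by rewrite !bc_coord_in linearZr_LR /= !linearZ /= !map_mxZ scalerA.
Qed.

End BaseChange.

Section Multilinear.
Variable R : comNzRingType.

(* Tensor products, symmetric and exterior powers are taken up to isomorphism,
   through their universal properties. *)
Definition is_tensor (M1 M2 N : vectType R) (b : {bilinear M1 -> M2 -> N}) : Prop :=
  forall (P : lmodType R) (c : {bilinear M1 -> M2 -> P}),
    (exists h : {linear N -> P}, forall x y, c x y = h (b x y)) /\
    (forall h h' : {linear N -> P},
       (forall x y, h (b x y) = h' (b x y)) -> h =1 h').

(* D is the dual of M through the pairing ev: D -> Hom(M, R) is bijective. *)
Definition is_dual (M D : vectType R) (ev : {bilinear D -> M -> R^o}) : Prop :=
  forall l : 'Hom(M, R^o), exists! d : D, forall x, ev d x = l x.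

Definition fupd (k : nat) (M : Type) (u : {ffun 'I_k -> M}) (i : 'I_k) (x : M) :
    {ffun 'I_k -> M} :=
  [ffun j => if j == i then x else u j].

Definition multilinear (k : nat) (M N : lmodType R) (m : {ffun 'I_k -> M} -> N) : Prop :=
  forall (u : {ffun _ -> _}) i (a : R) x y,
    m (fupd u i (a *: x + y)) = a *: m (fupd u i x) + m (fupd u i y).

Definition symmetric_map (k : nat) (M N : lmodType R) (m : {ffun 'I_k -> M} -> N) : Prop :=
  forall (u : {ffun _ -> _}) (s : {perm 'I_k}), m [ffun i => u (s i)] = m u.

Definition alternating_map (k : nat) (M N : lmodType R) (m : {ffun 'I_k -> M} -> N) : Prop :=
  forall (u : {ffun _ -> _}) i j, i != j -> u i = u j -> m u = 0.

Definition is_sym_power (k : nat) (M N : vectType R) (m : {ffun 'I_k -> M} -> N) : Prop :=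
  [/\ multilinear m, symmetric_map m &
    forall (P : lmodType R) (c : {ffun 'I_k -> M} -> P),
      multilinear c -> symmetric_map c ->
      (exists h : {linear N -> P}, forall u, c u = h (m u)) /\
      (forall h h' : {linear N -> P}, (forall u, h (m u) = h' (m u)) -> h =1 h')].

Definition is_ext_power (k : nat) (M N : vectType R) (m : {ffun 'I_k -> M} -> N) : Prop :=
  [/\ multilinear m, alternating_map m &
    forall (P : lmodType R) (c : {ffun 'I_k -> M} -> P),
      multilinear c -> alternating_map c ->
      (exists h : {linear N -> P}, forall u, c u = h (m u)) /\
      (forall h h' : {linear N -> P}, (forall u, h (m u) = h' (m u)) -> h =1 h')].

End Multilinear.

Section Span.
Variables (F : fieldType) (V : vectType F).

(* The subspace spanned by a set (see [span_setP]). *)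
Definition span_set (A : set V) : {vspace V} :=
  xget 0%VS [set U : {vspace V} |
    forall v, v \in U <-> exists2 s : seq V, (forall w, w \in s -> A w) & v \in <<s>>%VS].

Lemma span_setP (A : set V) v :
  v \in span_set A <->
  exists2 s : seq V, (forall w, w \in s -> A w) & v \in <<s>>%VS.
Proof.
rewrite /span_set; set P := [set _ | _].
suff: P (xget 0%VS P) by apply.
apply: xgetPex; rewrite /P {P} /=.
pose Q n := `[< exists2 s : seq V, (forall w, w \in s -> A w) & \dim <<s>> = n >].
have Q0 : exists n, Q n.
  by exists 0%N; apply/asboolP; exists [::] => //; rewrite span_nil dimv0.
have Qb n : Q n -> (n <= \dim {:V})%N.
  by move=> /asboolP[s _ <-]; exact: dimvS (subvf _).
have [n /asboolP[s As <-] smax] := ex_maxnP Q0 Qb.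
exists <<s>>%VS => u; split=> [us|[t At ut]]; first by exists s.
have st : (<<s>> <= <<s ++ t>>)%VS by rewrite span_cat addvSl.
have : <<s>>%VS == <<s ++ t>>%VS.
  rewrite eqEdim st smax //; apply/asboolP; exists (s ++ t) => // w.
  by rewrite mem_cat => /orP[/As|/At].
by move/eqP->; rewrite span_cat; apply: subvP ut; exact: addvSr.
Qed.

End Span.

Section Filtrations.
Variables (R : realType) (F : fieldType).

Definition is_filtration (V : vectType F) (Fil : R -> {vspace V}) : Prop :=
  [/\ forall g g', g <= g' -> (Fil g' <= Fil g)%VS,
      forall v, exists g, v \in Fil g,
      forall v, (forall g, v \in Fil g) -> v = 0 &
      forall g v, (forall g', g' < g -> v \in Fil g') -> v \in Fil g].

(* F^{> g}, the union of the F^{g'} with g' > g *)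
Definition fil_gt (V : vectType F) (Fil : R -> {vspace V}) (g : R) : {vspace V} :=
  span_set [set v | exists2 g', g < g' & v \in Fil g'].

Definition fil_tensor (V1 V2 W : vectType F) (b : V1 -> V2 -> W)
    (Fil1 : R -> {vspace V1}) (Fil2 : R -> {vspace V2}) (g : R) : {vspace W} :=
  span_set [set w | exists g1 g2 x y,
    [/\ g1 + g2 = g, x \in Fil1 g1, y \in Fil2 g2 & w = b x y]].

(* The image under a multilinear map m : V^k -> W of the filtration of the k-th
   tensor power of V.  For k > 0 the condition could read [\sum_i g_ i = g],
   as Fil is decreasing; with an inequality the formula also gives the filtration
   of the unit object (jump at 0) for k = 0. *)
Definition fil_power (k : nat) (V W : vectType F) (m : {ffun 'I_k -> V} -> W)
    (Fil : R -> {vspace V}) (g : R) : {vspace W} :=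
  span_set [set w | exists (g_ : 'I_k -> R) (x : {ffun 'I_k -> V}),
    [/\ g <= \sum_i g_ i, forall i, x i \in Fil (g_ i) & w = m x]].

(* The type of a filtration, as a nonincreasing sequence of length dim V. *)
Definition fil_type (V : vectType F) (Fil : R -> {vspace V}) : seq R :=
  xget [::] [set t : seq R |
    [/\ size t = \dim {:V}, sorted (fun x y => y <= x) t &
        forall g, count_mem g t = (\dim (Fil g) - \dim (fil_gt Fil g))%N]].

End Filtrations.

Definition type_cat (R : realType) (s t : seq R) : seq R :=
  sort (fun x y => y <= x) (s ++ t).

Definition type_le (R : realType) (s t : seq R) : Prop :=
  [/\ size s = size t,
      forall k, (k <= size s)%N ->
        \sum_(x <- take k s) x <= \sum_(x <- take k t) x &
      \sum_(x <- s) x = \sum_(x <- t) x].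

Section PhiModules.
Variables (R : realType) (p : nat) (E : padic_field R p).
Variables (K : perfectoid_ext E) (T : tilt K).

Local Notation O := (vring (tl_abs T)).
Local Notation phi := (@tl_frob R p E K T : {rmorphism O -> O}).
Local Notation incl := (@vr_val R T (tl_abs T) : {rmorphism O -> T}).

Record phi_mod := PhiMod {
  pm_mod :> vectType O;
  pm_phi : 'Hom(bc incl (bc phi pm_mod), bc incl pm_mod);
  pm_bij : bijective pm_phi
}.

Definition phi_morphism (M N : phi_mod) (g : 'Hom(M, N)) : Prop :=
  forall u, bc_hom incl g (pm_phi M u) = pm_phi N (bc_hom incl (bc_hom phi g) u).

Definition short_exact (M1 M2 M3 : phi_mod) (i : 'Hom(M1, M2)) (s : 'Hom(M2, M3))
    : Prop :=
  [/\ phi_morphism i, phi_morphism s, injective i,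
      forall y, s y = 0 <-> exists x, y = i x & forall z, exists y, s y = z].

Definition phi_tensor (M1 M2 N : phi_mod) (b : {bilinear M1 -> M2 -> N}) : Prop :=
  is_tensor b /\
  forall u v, pm_phi N (bc_bil (f := incl) (bc_bil (f := phi) b) u v)
    = bc_bil (f := incl) b (pm_phi M1 u) (pm_phi M2 v).

(* The second condition says that phi_D is the inverse of the transpose of
   phi_M. *)
Definition phi_dual (M D : phi_mod) (ev : {bilinear D -> M -> O^o}) : Prop :=
  is_dual ev /\
  forall u v, bc_form (f := incl) ev (pm_phi D u) (pm_phi M v)
    = bc_form (f := incl) (bc_form (f := phi) ev) u v.

Definition phi_compat_power (k : nat) (M N : phi_mod)
    (m : {ffun 'I_k -> M} -> N) : Prop :=
  forall u, pm_phi N (bc_mul (f := incl) (bc_mul (f := phi) m) u)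
    = bc_mul (f := incl) m [ffun j => pm_phi M (u j)].

Definition phi_sym_power (k : nat) (M N : phi_mod) (m : {ffun 'I_k -> M} -> N) : Prop :=
  is_sym_power m /\ phi_compat_power m.

Definition phi_ext_power (k : nat) (M N : phi_mod) (m : {ffun 'I_k -> M} -> N) : Prop :=
  is_ext_power m /\ phi_compat_power m.

Variable F : residue_field (tl_abs T).
Local Notation res := (rf_map F).

Definition red (M : phi_mod) : vectType F := bc res M.

(* The lattice M' = phi_M(phi^* M). *)
Definition phi_image (M : phi_mod) : set (bc incl M) :=
  [set w | exists x : bc phi M, w = pm_phi M (bc_in incl x)].

(* I(g) M' *)
Definition scaled_image (M : phi_mod) (g : R) : set (bc incl M) :=
  [set w | exists (n : nat) (a : 'I_n -> T) (y : 'I_n -> bc incl M),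
    [/\ forall i, tl_abs T (a i) <= (pf_q E)%:R `^ (- g),
        forall i, phi_image (y i) & w = \sum_i a i *: y i]].

(* The image of M /\ I(g) M' in M / m M; it is a subspace, so taking the span only
   serves to make it a [{vspace _}]. *)
Definition hodge (M : phi_mod) (g : R) : {vspace red M} :=
  span_set [set v | exists2 x : M, scaled_image g (bc_in incl x) & v = bc_in res x].

Definition hodge_type (M : phi_mod) : seq R := fil_type (hodge M).

(* Exactness of 0 -> F^g(M1) -> F^g(M2) -> F^g(M3) -> 0; the three equations also
   say that the maps are well defined. *)
Definition hodge_exact (M1 M2 M3 : phi_mod) (i : 'Hom(M1, M2)) (s : 'Hom(M2, M3))
    (g : R) : Prop :=
  [/\ (hodge M1 g :&: lker (bc_hom res i) = 0)%VS,
      (bc_hom res i @: hodge M1 g = hodge M2 g :&: lker (bc_hom res s))%VS &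
      (bc_hom res s @: hodge M2 g = hodge M3 g)%VS].

End PhiModules.

(* Main.v *)
(** A lattice over a valuation ring has elementary divisors: each object M has a
    basis (e_i) such that (x_i e_i) is a basis of M' = phi_M (phi^* M), and then
    the Hodge filtration in degree g is spanned by the reductions of the e_i with
    g <= log_q |x_i|.  Universal properties turn such bases into bases of the same
    kind for tensor products, duals, symmetric and exterior powers.

    For an exact sequence, let (x_i), (y_j), (z_k) be the elementary divisors of
    M1, M3, M2, and let a be in K^flat.  The covolume of the lattice M2 + a M2' is
    prod_k max(1, |a z_k|), and this lattice contains a flag of vectors, triangular
    with respect to the sequence, of determinant
    prod_i max(1, |a x_i|) prod_j max(1, |a y_j|).  Letting a vary, this inequality
    is the one between Hodge types.  If the types agree then the flag is a basis,
    so that (M2 + a M2') /\ M1[1/varpi] = M1 + a M1'; for a = 1 / y_j this allows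
    one to lift the j-th adapted vector of M3 to M2 /\ a M2', which gives the
    surjectivity on Hodge filtrations, and a dimension count gives the rest. *)

Require Import Defs.
From HB Require Import structures.
From mathcomp Require Import all_boot all_order all_algebra.
From mathcomp Require Import fingroup perm sesquilinear.
From mathcomp Require Import boolp classical_sets reals exp.

Set Implicit Arguments.
Unset Strict Implicit.
Unset Printing Implicit Defensive.

Import Order.TTheory GRing.Theory Num.Theory VectorInternalTheory.

Local Open Scope ring_scope.

(** * Elementary divisors over a valuation ring *)

(** The valuation ring need not be noetherian, so elementary divisors come from pivoting on an entry
    of largest absolute value, which divides all the others. Universal constructions prescribe
    Frobenius on phi^* N, so for each M two bases are kept: (e_i) of M and (w_i) of phi^* M, with
    phi_M(w_i) = x_i e_i. For an exact sequence the obstacle is that no adapted basis of M2 is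
    compatible with the sequence in general: a vector of M3 has a lift coming from M2 and another
    coming from M2', and they differ by an element of M1 (x) K^flat. Determinants avoid choosing a
    common lift, since their absolute value does not depend on the basis of M2. The link with types
    is that log_q of prod_k max(1, |a z_k|) is sum_k max(0, log_q |z_k| - c) with c = - log_q |a|.
    Only c in the value group arise in this way; this is enough because majorization need only be
    tested at the entries of the larger type. Conversely, exactness in every degree makes dimensions
    additive, and these dimensions determine the multiplicities. *)

Section ValuationRing.
Variables (R : realType) (L : fieldType) (v : absval R L).
Local Notation O := (vring v).
Local Notation incl := (@vr_val R L v : {rmorphism O -> L}).

Lemma absV x : v x^-1 = (v x)^-1.
Proof.
have [->|x0] := eqVneq x 0; first by rewrite invr0 abs0 invr0.
have vx0 : v x != 0 by rewrite abs_eq0.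
by apply: (mulfI vx0); rewrite -absM !divff // abs1.
Qed.

Lemma abs_gt0 x : (0 < v x) = (x != 0).
Proof. by rewrite lt_def abs_ge0 abs_eq0 andbT. Qed.

Lemma abs_sum_le (I : Type) (r : seq I) (P : pred I) (F : I -> L) c :
  0 <= c -> (forall i, P i -> v (F i) <= c) -> v (\sum_(i <- r | P i) F i) <= c.
Proof.
move=> c0 Fc; elim/big_ind: _ => [|x y|//]; first by rewrite abs0.
exact: abs_le_max.
Qed.

Lemma abs_prod (I : Type) (r : seq I) (P : pred I) (F : I -> L) :
  v (\prod_(i <- r | P i) F i) = \prod_(i <- r | P i) v (F i).
Proof. by elim/big_rec2: _ => [|i x y _ <-]; rewrite ?abs1 ?absM. Qed.

Lemma abs_sign (b : bool) : v ((-1) ^+ b) = 1.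
Proof. by case: b; rewrite ?expr0 ?expr1 ?absN abs1. Qed.

(** Ultrametric Hadamard inequality: every Leibniz term obeys the same bound, and summing them costs
    no factor. *)
Lemma abs_det_le n (A : 'M[L]_n) (z : 'I_n -> R) :
  (forall i j, v (A i j) <= z j) -> v (\det A) <= \prod_j z j.
Proof.
move=> Az; have z0 j : 0 <= z j by apply: le_trans (Az j j); exact: abs_ge0.
apply: abs_sum_le => [|s _]; first by apply: prodr_ge0 => j _.
(* Reindexing by the inverse permutation turns the product over rows into one over columns, on which
   [z] depends. *)
rewrite absM abs_sign mul1r abs_prod (reindex_inj (@perm_inj _ s^-1)) /=.
apply: ler_prod => j _; rewrite abs_ge0 permKV; exact: Az.
Qed.

Definition to_vring (x : L) : O := insubd 0 x.

Lemma to_vringK x : v x <= 1 -> vr_val (to_vring x) = x.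
Proof. by move=> x1; rewrite /to_vring [vr_val _]insubdK. Qed.

Lemma vring_quot x y : v x <= v y -> exists a : O, x = vr_val a * y.
Proof.
move=> xy; have [y0|y0] := eqVneq y 0.
  exists 0; rewrite y0 mulr0; apply/eqP; rewrite -(abs_eq0 v).
  by rewrite eq_le abs_ge0 andbT (le_trans xy) // y0 abs0.
exists (to_vring (x / y)); rewrite to_vringK ?divfK //.
by rewrite absM absV ler_pdivrMr ?abs_gt0 // mul1r.
Qed.

(** The form P A = D Q is read row by row: new basis vector number i of the source is sent to [x] i
    times new basis vector number i of the target. Since A may be singular, entries of [x] may
    vanish here. *)
Definition diagonalizable_mx n (A : 'M[L]_n) :=
  exists P P' Q Q' : 'M[O]_n, exists x : 'rV[L]_n,
  [/\ P *m P' = 1%:M, Q *m Q' = 1%:M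
    & map_mx incl P *m A = diag_mx x *m map_mx incl Q].

Lemma diagonalizable_equiv n (A : 'M[L]_n) (U U' V V' : 'M[O]_n) :
  U *m U' = 1%:M -> V *m V' = 1%:M ->
  diagonalizable_mx (map_mx incl U *m A *m map_mx incl V) -> diagonalizable_mx A.
Proof.
move=> UU VV [P [P' [Q [Q' [x [PP QQ PA]]]]]].
exists (P *m U), (U' *m P'), (Q *m V'), (V *m Q'), x; split.
- by rewrite -mulmxA (mulmxA U) UU mul1mx.
- by rewrite -mulmxA (mulmxA V') (mulmx1C VV) mul1mx.
rewrite !map_mxM mulmxA -PA -!mulmxA; congr (_ *m (_ *m _)).
by rewrite -map_mxM VV map_mx1 mulmx1.
Qed.

(** Gaussian elimination on an entry of maximal absolute value: it divides every other entry, so one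
    round clears its row and column, and induction treats the remaining block. *)
Lemma smith_diagonal n (A : 'M[L]_n) : diagonalizable_mx A.
Proof.
elim: n A => [|n IHn] A.
  by exists 1%:M, 1%:M, 1%:M, 1%:M, 0; split; rewrite ?mul1mx //;
     apply/matrixP=> -[].
pose z := [arg max_(z > (ord0, ord0) : 'I_n.+1 * 'I_n.+1) v (A z.1 z.2)]%O.
have zmax i j : v (A i j) <= v (A z.1 z.2).
  by rewrite /z; case: arg_maxP => // w _ /(_ (i, j) isT).
pose Sw k : 'M[O]_n.+1 := tperm_mx ord0 k.
have SwK k : Sw k *m Sw k = 1%:M.
  by rewrite /Sw /tperm_mx -perm_mxM tperm2 perm_mx1.
apply: (diagonalizable_equiv (SwK z.1) (SwK z.2)).
set B := _ *m _ *m _.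
have BE i j : B i j = A (tperm ord0 z.1 i) (tperm ord0 z.2 j).
  rewrite /B /Sw /tperm_mx !map_perm_mx -row_permE.
  rewrite -[X in perm_mx X]invgK -col_permE tpermV !mxE //.
have Bmax i j : v (B i j) <= v (B ord0 ord0) by rewrite !BE !tpermL.
move: B Bmax {BE} => B Bmax.
(* Multipliers that clear the first column; those for the first row follow. *)
have [c cB] := choice (fun i => vring_quot (Bmax (lift ord0 i) ord0)).
have [d dB] := choice (fun i => vring_quot (Bmax ord0 (lift ord0 i))).
pose C : 'cV[O]_n := \col_i c i; pose D : 'rV[O]_n := \row_i d i.
pose U : 'M[O]_(1 + n) := block_mx 1%:M 0 (- C) 1%:M.
pose U' : 'M[O]_(1 + n) := block_mx 1%:M 0 C 1%:M.
pose V : 'M[O]_(1 + n) := block_mx 1%:M (- D) 0 1%:M.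
pose V' : 'M[O]_(1 + n) := block_mx 1%:M D 0 1%:M.
have UU : U *m U' = 1%:M.
  rewrite mulmx_block !(mul1mx, mulmx1, mul0mx, mulmx0, addr0, add0r) addNr.
  by rewrite -scalar_mx_block.
have VV : V *m V' = 1%:M.
  rewrite mulmx_block !(mul1mx, mulmx1, mul0mx, mulmx0, addr0, add0r) subrr.
  by rewrite -scalar_mx_block.
apply: (diagonalizable_equiv UU VV).
set b := B ord0 ord0.
pose B1 : 'M[L]_(1 + n) := B.
pose S := drsubmx B1 - map_mx incl C *m ursubmx B1.
have eqB : map_mx incl U *m B1 *m map_mx incl V = block_mx b%:M 0 0 S.
  have Bl : dlsubmx B1 = map_mx incl C *m b%:M.
    apply/matrixP=> i j; rewrite mul_mx_scalar !mxE (ord1 j) mulrC -cB.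
    by congr (B _ _); apply/val_inj.
  have Bu : ursubmx B1 = b%:M *m map_mx incl D.
    apply/matrixP=> i j; rewrite mul_scalar_mx !mxE (ord1 i) mulrC -dB.
    by congr (B _ _); apply/val_inj.
  have Bb : ulsubmx B1 = b%:M.
    apply/matrixP=> i j; rewrite !mxE (ord1 i) (ord1 j) eqxx mulr1n.
    by congr (B _ _); apply/val_inj.
  rewrite -[in LHS](submxK B1) Bl Bb.
  rewrite !map_block_mx !mulmx_block !map_mx0 !map_mx1 !map_mxN.
  rewrite !(mul1mx, mulmx1, mul0mx, mulmx0, addr0, add0r).
  rewrite !mulNmx !mulmxN !addNr mul0mx oppr0 add0r.
  by rewrite [in X in block_mx _ X]Bu addNr /S [in RHS]addrC.
apply: (eq_ind_r (@diagonalizable_mx (1 + n)) _ eqB).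
have [P [P' [Q [Q' [x [PP QQ PA]]]]]] := IHn S.
pose ext (X : 'M[O]_n) : 'M[O]_(1 + n) := block_mx 1%:M 0 0 X.
have extM X Y : X *m Y = 1%:M -> ext X *m ext Y = 1%:M.
  move=> XY; rewrite mulmx_block !(mul1mx, mulmx1, mul0mx, mulmx0, addr0, add0r).
  by rewrite XY -scalar_mx_block.
pose y : 'rV[L]_(1 + n) := row_mx b%:M x.
exists (ext P), (ext P'), (ext Q), (ext Q'), y; split; [exact: extM..|].
rewrite /ext /y !map_block_mx diag_mx_row !mulmx_block !map_mx0 !map_mx1.
rewrite !(mul1mx, mulmx1, mul0mx, mulmx0, addr0, add0r) PA.
congr (block_mx _ _ _ _); apply/matrixP=> i j.
by rewrite !ord1 !mxE eqxx.
Qed.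

End ValuationRing.

(** * Bases of free modules and base change *)

Section Bases.
Variable A : comNzRingType.

(** Bases carry their coordinate forms and are indexed by any finite type: pairs of indices will
    serve for tensor products and orbits of index tuples for powers. *)
Definition is_basis (M : lmodType A) (I : finType) (e : I -> M) (c : I -> M -> A) :=
  [/\ forall i a x y, c i (a *: x + y) = a * c i x + c i y,
      forall x, x = \sum_i c i x *: e i
    & forall i j, c i (e j) = (i == j)%:R].

Variables (M : lmodType A) (I : finType) (e : I -> M) (c : I -> M -> A).
Hypothesis ec : is_basis e c.

Lemma basis_coord_is_linear i : linear (c i : M -> A^o).
Proof. by case: ec => clin _ _ a x y; rewrite clin. Qed.

Lemma basis_coord_lin i : exists l : {linear M -> A^o}, l =1 c i.
Proof.
by exists (HB.pack_for {linear M -> A^o} (c i : M -> A^o)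
  (GRing.isLinear.Build A _ _ _ _ (basis_coord_is_linear i))).
Qed.

Lemma basis_coord_sum i (a : I -> A) : c i (\sum_j a j *: e j) = a i.
Proof.
have [l lc] := basis_coord_lin i; case: ec => _ _ cE.
rewrite -lc linear_sum (bigD1 i) //= linearZ /= lc cE eqxx big1 ?addr0.
  exact: mulr1.
by move=> j ji; rewrite linearZ /= lc cE eq_sym (negPf ji) scaler0.
Qed.

Lemma basis_coord0 i : c i 0 = 0.
Proof. by have [l lc] := basis_coord_lin i; rewrite -lc linear0. Qed.

Lemma basis_coordZ i a x : c i (a *: x) = a * c i x.
Proof. by have [l lc] := basis_coord_lin i; rewrite -!lc linearZ. Qed.

Lemma basis_coordB i x y : c i (x - y) = c i x - c i y.
Proof. by have [l lc] := basis_coord_lin i; rewrite -!lc linearB. Qed.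

Lemma basis_coord_big i (J : Type) (r : seq J) (P : pred J) (F : J -> M) :
  c i (\sum_(j <- r | P j) F j) = \sum_(j <- r | P j) c i (F j).
Proof.
have [l lc] := basis_coord_lin i; rewrite -lc linear_sum.
by apply: eq_bigr => j _; rewrite lc.
Qed.

Lemma basis_coord_inj x y : (forall i, c i x = c i y) -> x = y.
Proof.
case: ec => _ cx _ xy; rewrite (cx x) (cx y).
by apply: eq_bigr => i _; rewrite xy.
Qed.

End Bases.

Lemma is_basis_of_free (A : comNzRingType) (M : lmodType A) (I : finType) (e : I -> M) :
  (forall x, exists a : I -> A, x = \sum_i a i *: e i) ->
  (forall a : I -> A, \sum_i a i *: e i = 0 -> forall i, a i = 0) ->
  exists c, is_basis e c.
Proof.
move=> gen free; have [a aE] := choice gen.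
(* The chosen coefficients are arbitrary functions; freeness makes them unique, and uniqueness makes
   them linear. *)
have uniq (b b' : I -> A) : \sum_i b i *: e i = \sum_i b' i *: e i -> b =1 b'.
  move=> bb i; apply/eqP; rewrite -subr_eq0; apply/eqP.
  apply: (free (fun i => b i - b' i)).
  by under eq_bigr do rewrite scalerBl; rewrite sumrB bb subrr.
exists (fun i x => a x i); split=> [i b x y|x|i j]; last 1 first.
- suff -> : a (e j) =1 fun i => (i == j)%:R by [].
  apply: uniq; rewrite -aE (bigD1 j) //= eqxx scale1r big1 ?addr0 // => k kj.
  by rewrite (negPf kj) scale0r.
- have : a (b *: x + y) =1 fun i => b * a x i + a y i; last exact.
  apply: uniq; rewrite -aE; under [RHS]eq_bigr do rewrite scalerDl -scalerA.
  by rewrite big_split /= -scaler_sumr -!aE.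
- exact: aE.
Qed.

Section BaseChange.
Variables (A S : comNzRingType) (f : {rmorphism A -> S}).

Lemma bc_in_linear (M : vectType A) a (x y : M) :
  bc_in f (a *: x + y) = f a *: bc_in f x + bc_in f y.
Proof. by rewrite /bc_in linearP map_mxD map_mxZ. Qed.

Lemma bc_in0 (M : vectType A) : bc_in f (0 : M) = 0.
Proof. by rewrite /bc_in linear0 map_mx0. Qed.

Lemma bc_inZ (M : vectType A) a (x : M) : bc_in f (a *: x) = f a *: bc_in f x.
Proof. by rewrite /bc_in linearZ /= map_mxZ. Qed.

Lemma bc_inD (M : vectType A) (x y : M) : bc_in f (x + y) = bc_in f x + bc_in f y.
Proof. by rewrite /bc_in linearD /= map_mxD. Qed.

Lemma bc_in_sum (M : vectType A) (J : Type) (r : seq J) (P : pred J) (F : J -> M) :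
  bc_in f (\sum_(j <- r | P j) F j) = \sum_(j <- r | P j) bc_in f (F j).
Proof. by elim/big_rec2: _ => [|j x y _ <-]; rewrite ?bc_in0 ?bc_inD. Qed.

Lemma bc_in_lincomb (M : vectType A) (J : finType) (a : J -> A) (F : J -> M) :
  bc_in f (\sum_j a j *: F j) = \sum_j f (a j) *: bc_in f (F j).
Proof. by rewrite bc_in_sum; apply: eq_bigr => j _; rewrite bc_inZ. Qed.

Lemma bc_in_inj (M : vectType A) : injective f -> injective (@bc_in _ _ f M).
Proof.
move=> finj x y /matrixP xy; apply: (can_inj v2rK); apply/matrixP=> i j.
by apply: finj; have := xy i j; rewrite !mxE.
Qed.

Lemma bc_coord_linear (M : vectType A) a (u w : bc f M) i :
  bc_coord (a *: u + w) i = a * bc_coord u i + bc_coord w i.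
Proof. by rewrite /bc_coord !mxE. Qed.

Lemma bc_coord_vb (M : vectType A) (i j : 'I_(dim M)) :
  bc_coord (bc_in f (vb i)) j = (j == i)%:R.
Proof. by rewrite bc_coord_in r2vK !mxE eqxx rmorph_nat. Qed.

Lemma bc_sum (M : vectType A) (u : bc f M) :
  u = \sum_i bc_coord u i *: bc_in f (vb i).
Proof.
apply/rowP=> j; rewrite summxE (bigD1 j) //= big1 => [|i ij].
  by rewrite mxE [X in _ * X](bc_coord_vb j j) eqxx mulr1 addr0.
by rewrite mxE [X in _ * X](bc_coord_vb i j) eq_sym (negPf ij) mulr0.
Qed.

(** The S-linear extension of a linear form; applied to coordinate forms it gives the coordinates in
    the base-changed basis. *)
Definition bc_fun (M : vectType A) (l : M -> A) (u : bc f M) : S :=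
  \sum_j bc_coord u j * f (l (vb j)).

Lemma bc_basis_vb (M : vectType A) :
  is_basis (fun i => bc_in f (@vb _ M i)) (fun i u => bc_coord u i).
Proof.
split=> [i a u w|u|i j]; [exact: bc_coord_linear|exact: bc_sum|].
exact: bc_coord_vb.
Qed.

Lemma vb_basis (M : vectType A) :
  is_basis (@vb _ M) (fun i x => (v2r x) 0 i).
Proof.
split=> [i a x y|x|i j]; first by rewrite linearP !mxE.
  exact: vb_sum.
by rewrite r2vK !mxE eqxx.
Qed.

Section BasisBaseChange.
Variables (M : vectType A) (I : finType) (e : I -> M) (c : I -> M -> A).
Hypothesis ec : is_basis e c.

Lemma bc_fun_in i x : bc_fun (c i) (bc_in f x) = f (c i x).
Proof.
rewrite /bc_fun [in RHS](vb_sum x) (basis_coord_big ec) rmorph_sum /=.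
by apply: eq_bigr => j _; rewrite bc_coord_in (basis_coordZ ec) rmorphM.
Qed.

Lemma bc_basis : is_basis (fun i => bc_in f (e i)) (fun i => bc_fun (c i)).
Proof.
split=> [i a u w|u|i j]; last by rewrite bc_fun_in; case: ec => _ _ ->; rewrite rmorph_nat.
  rewrite /bc_fun mulr_sumr -big_split; apply: eq_bigr => j _ /=.
  by rewrite bc_coord_linear mulrDl mulrA.
rewrite {1}(bc_sum u) /bc_fun; under [RHS]eq_bigr do rewrite scaler_suml.
rewrite exchange_big; apply: eq_bigr => j _ /=.
have {1}-> : vb j = \sum_i c i (vb j) *: e i by case: ec => _ + _; apply.
rewrite bc_in_lincomb scaler_sumr.
by apply: eq_bigr => i _; rewrite scalerA.
Qed.

End BasisBaseChange.

Section Bilinear.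
Variables (M1 M2 N : vectType A).

Lemma bc_bil_linearl (b : M1 -> M2 -> N) w a (u u' : bc f M1) :
  bc_bil (f := f) b (a *: u + u') w = a *: bc_bil (f := f) b u w + bc_bil (f := f) b u' w.
Proof.
rewrite /bc_bil scaler_sumr -big_split; apply: eq_bigr => i _ /=.
rewrite scaler_sumr -big_split; apply: eq_bigr => j _ /=.
by rewrite bc_coord_linear mulrDl scalerDl -mulrA scalerA.
Qed.

Lemma bc_bil_linearr (b : M1 -> M2 -> N) w a (u u' : bc f M2) :
  bc_bil (f := f) b w (a *: u + u') = a *: bc_bil (f := f) b w u + bc_bil (f := f) b w u'.
Proof.
rewrite /bc_bil scaler_sumr -big_split; apply: eq_bigr => i _ /=.
rewrite scaler_sumr -big_split; apply: eq_bigr => j _ /=.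
by rewrite bc_coord_linear mulrDr scalerDl mulrCA scalerA.
Qed.

HB.instance Definition _ (b : M1 -> M2 -> N) :=
  bilinear_isBilinear.Build S (bc f M1) (bc f M2) (bc f N) *:%R *:%R (bc_bil (f := f) b)
    (conj (fun w a u u' => bc_bil_linearl b w a u u') (bc_bil_linearr b)).

Lemma bc_form_linearl (b : M1 -> M2 -> A) w a (u u' : bc f M1) :
  bc_form (f := f) b (a *: u + u') w = a * bc_form (f := f) b u w + bc_form (f := f) b u' w.
Proof.
rewrite /bc_form mulr_sumr -big_split; apply: eq_bigr => i _ /=.
rewrite mulr_sumr -big_split; apply: eq_bigr => j _ /=.
by rewrite bc_coord_linear !mulrDl !mulrA.
Qed.

Lemma bc_form_linearr (b : M1 -> M2 -> A) w a (u u' : bc f M2) :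
  bc_form (f := f) b w (a *: u + u') = a * bc_form (f := f) b w u + bc_form (f := f) b w u'.
Proof.
rewrite /bc_form mulr_sumr -big_split; apply: eq_bigr => i _ /=.
rewrite mulr_sumr -big_split; apply: eq_bigr => j _ /=.
by rewrite bc_coord_linear mulrDr mulrDl !mulrA (mulrC _ a) ?mulrA.
Qed.

HB.instance Definition _ (b : M1 -> M2 -> A) :=
  bilinear_isBilinear.Build S (bc f M1) (bc f M2) S^o *:%R *:%R
    (bc_form (f := f) b : bc f M1 -> bc f M2 -> S^o)
    (conj (fun w a u u' => bc_form_linearl b w a u u') (bc_form_linearr b)).

Lemma bc_formE (b : {bilinear M1 -> M2 -> A^o}) x y :
  bc_form (f := f) b (bc_in f x) (bc_in f y) = f (b x y).
Proof.
rewrite {2}(vb_sum x) linear_sumlz /bc_form rmorph_sum /=.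
apply: eq_bigr => i _.
rewrite linearZl_LR {2}(vb_sum y) linear_sumr scaler_sumr rmorph_sum /=.
apply: eq_bigr => j _.
by rewrite !bc_coord_in linearZr_LR /= !rmorphM mulrA.
Qed.

End Bilinear.

End BaseChange.

Section Multilinear.
Variables (A S : comNzRingType) (f : {rmorphism A -> S}) (k : nat).

(** Semilinearity along f covers two cases at once: multilinear maps, with f the identity, and their
    composites with [bc_in f]. *)
Definition multi_semilinear (M : lmodType A) (N : lmodType S) (m : {ffun 'I_k -> M} -> N) :=
  forall (u : {ffun _ -> _}) i (a : A) x y,
    m (fupd u i (a *: x + y)) = f a *: m (fupd u i x) + m (fupd u i y).

Lemma fupd_id (M : Type) (u : {ffun 'I_k -> M}) i : fupd u i (u i) = u.
Proof. by apply/ffunP=> j; rewrite ffunE; case: eqP => // ->. Qed.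

Lemma multi_semilinear_sum (M : lmodType A) (N : lmodType S)
    (m : {ffun 'I_k -> M} -> N) (J : finType) u i (a : J -> A) (x : J -> M) :
  multi_semilinear m ->
  m (fupd u i (\sum_j a j *: x j)) = \sum_j f (a j) *: m (fupd u i (x j)).
Proof.
move=> mm; elim/big_rec2: _ => [|j y z _ <-]; last exact: mm.
(* The empty sum: additivity at 0 = 1 * 0 + 0 shows that a zero argument gives the value 0. *)
have /eqP := mm u i 1 0 0.
by rewrite scale1r addr0 rmorph1 scale1r -subr_eq0 opprD addNKr oppr_eq0 => /eqP.
Qed.

End Multilinear.

(** * Multilinear maps *)

Section Multilinear.
Variables (A S : comNzRingType) (f : {rmorphism A -> S}) (k : nat).

Lemma multi_semilinear_ext (M : lmodType A) (N : lmodType S)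
    (m m' : {ffun 'I_k -> M} -> N) (I : finType) (e : I -> M) c :
  is_basis e c -> multi_semilinear f m -> multi_semilinear f m' ->
  (forall a : {ffun 'I_k -> I}, m [ffun i => e (a i)] = m' [ffun i => e (a i)]) ->
  m =1 m'.
Proof.
move=> ec mm mm' mE u.
(* [s] lists the slots that may not yet hold basis vectors; each induction step expands one of
   them. *)
suff main (s : seq 'I_k) (w : {ffun 'I_k -> M}) :
    (forall i, i \notin s -> exists j, w i = e j) -> m w = m' w.
  by apply: (main (enum 'I_k)) => i; rewrite mem_enum.
elim: s w => [|i s IHs] w wP.
  have [a aE] := choice (fun i => wP i isT).
  have -> : w = [ffun i => e ([ffun i => a i] i)] by apply/ffunP=> i; rewrite !ffunE.
  exact: mE.
rewrite -(fupd_id w i); have -> : w i = \sum_j c j (w i) *: e j by case: ec.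
rewrite (multi_semilinear_sum _ _ _ _ mm) (multi_semilinear_sum _ _ _ _ mm').
apply: eq_bigr => j _; congr (_ *: _); apply: IHs => l ls.
rewrite ffunE; case: eqVneq => [_|li]; first by exists j.
by apply: wP; rewrite inE negb_or li.
Qed.

Lemma multi_semilinear_prod (M : lmodType A) (N : lmodType S) (l : 'I_k -> M -> S) (n : N) :
  (forall i a x y, l i (a *: x + y) = f a * l i x + l i y) ->
  multi_semilinear f (fun u : {ffun 'I_k -> M} => (\prod_i l i (u i)) *: n).
Proof.
move=> llin u i a x y.
have E z : \prod_j l j (fupd u i z j) = l i z * \prod_(j | j != i) l j (u j).
  rewrite (bigD1 i) //= ffunE eqxx; congr (_ * _).
  by apply: eq_bigr => j ji; rewrite ffunE (negPf ji).
by rewrite !E llin mulrDl scalerDl -mulrA scalerA.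
Qed.

Lemma multi_semilinear_bigsum (M : lmodType A) (N : lmodType S) (J : Type) (r : seq J)
    (P : pred J) (m : J -> {ffun 'I_k -> M} -> N) :
  (forall j, multi_semilinear f (m j)) ->
  multi_semilinear f (fun u => \sum_(j <- r | P j) m j u).
Proof.
move=> mm u i a x y; rewrite scaler_sumr -big_split.
by apply: eq_bigr => j _; rewrite mm.
Qed.

Lemma bc_mul_multilinear (M N : vectType A) (m : {ffun 'I_k -> M} -> N) :
  multilinear (bc_mul (f := f) m).
Proof.
move=> u i a x y; rewrite /bc_mul scaler_sumr -big_split; apply: eq_bigr => g _ /=.
have E z : \prod_j bc_coord (fupd u i z j) (g j) =
    bc_coord z (g i) * \prod_(j | j != i) bc_coord (u j) (g j).
  rewrite (bigD1 i) //= ffunE eqxx; congr (_ * _).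
  by apply: eq_bigr => j ji; rewrite ffunE (negPf ji).
by rewrite !E bc_coord_linear mulrDl scalerDl -mulrA scalerA.
Qed.

End Multilinear.

Section MultilinearExpansion.
Variables (A : comNzRingType) (k : nat) (M N : lmodType A).
Variables (I : finType) (e : I -> M) (c : I -> M -> A).
Hypothesis ec : is_basis e c.

Lemma prod_delta (a g : {ffun 'I_k -> I}) :
  \prod_i ((g i == a i)%:R : A) = (g == a)%:R.
Proof.
have [->|ga] := eqVneq; first by rewrite big1 // => i _; rewrite eqxx.
have [i gai] : exists i, g i != a i.
  apply/existsP; rewrite -negb_forall; apply: contra ga => /forallP h.
  by apply/eqP/ffunP => i; apply/eqP.
by rewrite (bigD1 i) //= (negPf gai) mul0r.
Qed.

Lemma prod_coord_basis (a g : {ffun 'I_k -> I}) :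
  \prod_i c (g i) ([ffun i => e (a i)] i) = (g == a)%:R.
Proof.
rewrite -prod_delta; apply: eq_bigr => i _; rewrite ffunE.
by case: ec => _ _ ->.
Qed.

Lemma multilinear_expand (m : {ffun 'I_k -> M} -> N) u : multilinear m ->
  m u = \sum_(g : {ffun 'I_k -> I}) (\prod_i c (g i) (u i)) *: m [ffun i => e (g i)].
Proof.
move=> mm; apply: (@multi_semilinear_ext A A idfun k M N m
  (fun u => \sum_(g : {ffun 'I_k -> I}) (\prod_i c (g i) (u i)) *: m [ffun i => e (g i)])
  I e c ec mm) => [|a].
  apply: (@multi_semilinear_bigsum A A idfun) => g.
  apply: (@multi_semilinear_prod A A idfun k M N (fun i => c (g i))).
  by move=> i; case: ec => clin _ _; exact: clin.
rewrite (bigD1 a) //= prod_coord_basis eqxx scale1r big1 ?addr0 // => g ga.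
by rewrite prod_coord_basis (negPf ga) scale0r.
Qed.

Lemma multilinearZ (m : {ffun 'I_k -> M} -> N) (a : 'I_k -> A) (u : {ffun 'I_k -> M}) :
  multilinear m -> m [ffun i => a i *: u i] = (\prod_i a i) *: m u.
Proof.
move=> mm; rewrite !(multilinear_expand _ mm) scaler_sumr.
apply: eq_bigr => g _; rewrite scalerA -big_split; congr (_ *: _).
by apply: eq_bigr => i _; rewrite ffunE (basis_coordZ ec).
Qed.

End MultilinearExpansion.

(** Both sides are semilinear in each u i, so it is enough to compare them on tuples of basis
    vectors, where a single term of [bc_mul] survives. *)
Lemma bc_mulE (A S : comNzRingType) (f : {rmorphism A -> S}) (k : nat) (M N : vectType A)
    (m : {ffun 'I_k -> M} -> N) (u : {ffun 'I_k -> M}) : multilinear m ->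
  bc_mul (f := f) m [ffun i => bc_in f (u i)] = bc_in f (m u).
Proof.
move=> mm.
apply: (@multi_semilinear_ext A S f k M (bc f N)
  (fun u => bc_mul m [ffun i => bc_in f (u i)]) (fun u => bc_in f (m u))
  _ _ _ (vb_basis M)) => [w i a x y|w i a x y|a].
- have E z : [ffun j => bc_in f (fupd w i z j)] = fupd [ffun j => bc_in f (w j)] i (bc_in f z).
    by apply/ffunP=> j; rewrite !ffunE; case: eqP.
  by rewrite !E bc_in_linear bc_mul_multilinear.
- by rewrite mm bc_in_linear.
have E (g : {ffun _ -> _}) :
    \prod_i bc_coord ([ffun i => bc_in f ([ffun i => vb (a i)] i)] i) (g i) = (g == a)%:R.
  by rewrite -prod_delta; apply: eq_bigr => i _; rewrite !ffunE bc_coord_vb.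
rewrite /bc_mul (bigD1 a) //= E eqxx scale1r big1 ?addr0 // => g ga.
by rewrite E (negPf ga) scale0r.
Qed.

(** * Filtrations adapted to a basis *)

Section SpanSet.
Variables (k : fieldType) (V : vectType k).

Lemma mem_span_set (B : set V) v : B v -> v \in span_set B.
Proof.
move=> Bv; apply/span_setP; exists [:: v]; last by rewrite memv_span ?mem_head.
by move=> w; rewrite inE => /eqP->.
Qed.

Lemma span_set_sub (B : set V) (U : {vspace V}) :
  (forall v, B v -> v \in U) -> (span_set B <= U)%VS.
Proof.
move=> BU; apply/subvP => v /span_setP[s sB]; apply: subvP.
by apply/span_subvP => w /sB /BU.
Qed.

End SpanSet.

Section CoordSpace.
Variables (k : fieldType) (V : vectType k) (I : finType) (e : I -> V) (c : I -> V -> k).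
Hypothesis ec : is_basis e c.

Definition coord_space (P : pred I) : {vspace V} := <<[seq e i | i <- enum P]>>%VS.

Lemma mem_coord_space (P : pred I) v :
  v \in coord_space P <-> forall i, ~~ P i -> c i v = 0.
Proof.
split=> [/coord_span -> i Pi|cv].
  rewrite (basis_coord_big ec) big1 // => j _; rewrite (basis_coordZ ec).
  have jP : (j < size (enum P))%N by rewrite -cardE ltn_ord.
  have i0 : I := i; rewrite (nth_map i0) //; case: ec => _ _ ->.
  case: eqP => [ij|]; last by rewrite mulr0.
  by have := mem_nth i0 jP; rewrite -ij mem_enum unfold_in (negPf Pi).
case: ec => _ /(_ v) -> _; apply: memv_suml => i _; have [Pi|/cv ->] := boolP (P i).
  by rewrite memvZ // memv_span // map_f // mem_enum.
by rewrite scale0r mem0v.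
Qed.

Lemma dim_coord_space (P : pred I) : \dim (coord_space P) = #|P|.
Proof.
rewrite cardE -(size_map e); apply/eqP/freeP => a a0 j.
have jP : (j < size (enum P))%N by rewrite -cardE ltn_ord.
have i0 : I := enum_val j; pose i := nth i0 (enum P) j.
move: a0 => /(congr1 (c i)); rewrite (basis_coord0 ec) (basis_coord_big ec).
rewrite (bigD1 j) //= (basis_coordZ ec) (nth_map i0) //.
case: (ec) => _ _ cE; rewrite cE eqxx mulr1 big1 ?addr0 // => l lj.
have lP : (l < size (enum P))%N by rewrite -cardE ltn_ord.
rewrite (basis_coordZ ec) (nth_map i0) // cE /i nth_uniq ?enum_uniq //.
by rewrite eq_sym (negPf (_ : l != j :> nat)) ?mulr0.
Qed.

Lemma dim_basis : \dim {:V} = #|I|.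
Proof.
rewrite -(dim_coord_space predT); congr (\dim _); apply/vspaceP => v.
by rewrite memvf; apply/esym/mem_coord_space.
Qed.

Variables (R : realType) (g_ : I -> R).

Definition coord_fil (g : R) := coord_space [pred i | g <= g_ i].

Lemma mem_coord_fil g v :
  v \in coord_fil g <-> forall i, g_ i < g -> c i v = 0.
Proof.
split=> [/mem_coord_space h i ig|h]; first by apply: h; rewrite /= -ltNge.
by apply/mem_coord_space => i /=; rewrite -ltNge; exact: h.
Qed.

Lemma fil_gt_coord g : fil_gt coord_fil g = coord_space [pred i | g < g_ i].
Proof.
apply/eqP; rewrite eqEsubv; apply/andP; split.
  apply: span_set_sub => v [g' gg' /mem_coord_fil h].
  apply/mem_coord_space => i /=; rewrite -leNgt => ig.
  by apply: h; exact: le_lt_trans gg'.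
apply/subvP => v /mem_coord_space h; case: (ec) => _ /(_ v) -> _.
apply: memv_suml => i _; have [gi|/h ->] := boolP (g < g_ i); last by rewrite scale0r mem0v.
rewrite memvZ // mem_span_set //; exists (g_ i) => //.
by rewrite memv_span // map_f // mem_enum inE.
Qed.

Lemma dim_coord_fil g : \dim (coord_fil g) = count (fun x => g <= x) (codom g_).
Proof. by rewrite dim_coord_space count_map cardE size_filter -enumT; apply: eq_count. Qed.

Lemma coord_filtration : is_filtration coord_fil.
Proof.
split=> [g g' gg'|v|v h|g v h].
- apply/subvP => v /mem_coord_fil h; apply/mem_coord_fil => i ig.
  by apply: h; exact: lt_le_trans gg'.
- exists (\big[Order.min/0]_i g_ i); apply/mem_coord_fil => i.
  by rewrite ltNge bigmin_le_cond.
- apply: (basis_coord_inj ec) => i; rewrite (basis_coord0 ec).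
  by have /mem_coord_fil := h (g_ i + 1); apply; rewrite ltrDl.
- apply/mem_coord_fil => i ig.
  (* Left continuity: a degree strictly between the jump and g already kills coordinate i. *)
  have /mem_coord_fil := h ((g_ i + g) / 2) (midf_lt ig).2; apply.
  exact: (midf_lt ig).1.
Qed.

(** The type is defined by a choice; a sorted sequence is determined by its multiplicities, so the
    choice can only be the sorted list of jumps. *)
Lemma fil_type_coord :
  fil_type coord_fil = sort (fun x y => y <= x) (codom g_).
Proof.
rewrite /fil_type; set Q := (X in xget _ X).
have tot : total (fun x y : R => y <= x) by move=> x y; exact: le_total.
have geT : transitive (fun x y : R => y <= x) by move=> y x z xy yz; exact: le_trans xy.
have geA : antisymmetric (fun x y : R => y <= x) by move=> x y; rewrite andbC => /le_anti.
have dimE g : (\dim (coord_fil g) - \dim (fil_gt coord_fil g))%N = count_mem g (codom g_).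
  rewrite dim_coord_fil fil_gt_coord dim_coord_space.
  have -> : #|[pred i | g < g_ i]| = count (fun x => g < x) (codom g_).
    by rewrite count_map cardE size_filter -enumT; apply: eq_count.
  have -> : count (fun x => g <= x) (codom g_) =
      (count_mem g (codom g_) + count (fun x => (g < x)%R) (codom g_))%N.
    rewrite -count_predUI [X in (_ + X)%N](_ : _ = 0%N) ?addn0.
      by apply: eq_count => x /=; rewrite le_eqVlt eq_sym.
    apply/eqP; rewrite -leqn0 leqNgt -has_count; apply/hasPn => x _ /=.
    by apply/negP => /andP[/eqP->]; rewrite ltxx.
  by rewrite addnK.
have Qs : Q (sort (fun x y => y <= x) (codom g_)).
  split; first by rewrite size_sort size_map -cardE dim_basis cardT.
    exact: sort_sorted.
  by move=> g; rewrite dimE; apply/seq.permP; rewrite perm_sort.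
have Qu t : Q t -> t = sort (fun x y => y <= x) (codom g_).
  case=> _ tS tc; apply: (sorted_eq geT geA) => //; first exact: sort_sorted.
  rewrite perm_sym perm_sort perm_sym; apply/allP => g _; apply/eqP.
  by rewrite [LHS]tc dimE.
by apply: Qu; exact: xgetI Qs.
Qed.

End CoordSpace.

(** * Adapted bases of phi-modules *)

Lemma mx_basis (A : comNzRingType) (n : nat) (M : lmodType A) (P P' : 'M[A]_n)
    (e : 'I_n -> M) c : is_basis e c -> P *m P' = 1%:M ->
  is_basis (fun i => \sum_j P i j *: e j) (fun i x => \sum_j c j x * P' j i).
Proof.
move=> ec PP.
have cP i k : c k (\sum_j P i j *: e j) = P i k by rewrite (basis_coord_sum ec).
split=> [i a x y|x|i j].
- rewrite mulr_sumr -big_split; apply: eq_bigr => j _ /=.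
  by case: ec => -> _ _; rewrite mulrDl mulrA.
- apply: (basis_coord_inj ec) => k; rewrite (basis_coord_big ec).
  under eq_bigr => i _ do rewrite (basis_coordZ ec) cP.
  have /matrixP/(_ 0 k) : (\row_j c j x) *m (P' *m P) = \row_j c j x.
    by rewrite (mulmx1C PP) mulmx1.
  rewrite mulmxA !mxE => <-; apply: eq_bigr => i _.
  by rewrite !mxE; congr (_ * _); apply: eq_bigr => j _; rewrite mxE.
have /matrixP/(_ j i) := PP; rewrite !mxE eq_sym => <-.
by apply: eq_bigr => k _; rewrite cP.
Qed.

Section Adapted.
Variables (R : realType) (p : nat) (E : padic_field R p).
Variables (K : perfectoid_ext E) (T : tilt K).

Local Notation O := (vring (tl_abs T)).
Local Notation phi := (@tl_frob R p E K T : {rmorphism O -> O}).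
Local Notation incl := (@vr_val R T (tl_abs T) : {rmorphism O -> T}).

Definition log_abs (x : T) : R := ln (tl_abs T x) / ln (pf_q E)%:R.

Lemma pf_q_gt1 : 1 < (pf_q E)%:R :> R.
Proof. by rewrite ltr1n; exact: card_finNzRing_gt1. Qed.

Lemma ln_pf_q_gt0 : 0 < ln (pf_q E)%:R :> R.
Proof. by rewrite ln_gt0 // pf_q_gt1. Qed.

Lemma ler_pf_q_powR a b :
  ((pf_q E)%:R `^ a <= (pf_q E)%:R `^ b :> R) = (a <= b).
Proof.
have q0 : 0 < (pf_q E)%:R :> R by rewrite (lt_trans ltr01 pf_q_gt1).
by rewrite -ler_ln ?posrE ?powR_gt0 // !ln_powR ler_pM2r // ln_pf_q_gt0.
Qed.

Lemma log_absK x : x != 0 -> tl_abs T x = (pf_q E)%:R `^ log_abs x.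
Proof.
move=> x0; have vx : 0 < tl_abs T x by rewrite abs_gt0.
apply: ln_inj; rewrite ?posrE ?powR_gt0 ?(lt_trans ltr01 pf_q_gt1) //.
by rewrite ln_powR /log_abs divfK // gt_eqF // ln_pf_q_gt0.
Qed.

Lemma log_absM x y : x != 0 -> y != 0 -> log_abs (x * y) = log_abs x + log_abs y.
Proof.
move=> x0 y0; rewrite /log_abs absM lnM ?posrE ?abs_gt0 //.
by rewrite mulrDl.
Qed.

Lemma log_abs1 : log_abs 1 = 0.
Proof. by rewrite /log_abs abs1 ln1 mul0r. Qed.

Lemma log_absV x : x != 0 -> log_abs x^-1 = - log_abs x.
Proof.
move=> x0; apply/eqP; rewrite -subr_eq0 opprK -log_absM ?invr_eq0 //.
by rewrite mulVf // log_abs1.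
Qed.

Lemma log_abs_prod (I : finType) (x : I -> T) : (forall i, x i != 0) ->
  log_abs (\prod_i x i) = \sum_i log_abs (x i).
Proof.
move=> x0; suff: log_abs (\prod_i x i) = \sum_i log_abs (x i) /\ \prod_i x i != 0 by case.
elim/big_rec2: _ => [|i s y _ [ys y0]]; first by rewrite log_abs1 oner_neq0.
by rewrite log_absM // ys mulf_neq0.
Qed.

Lemma le_log_abs x g : x != 0 ->
  (g <= log_abs x) = (1 <= (pf_q E)%:R `^ (- g) * tl_abs T x).
Proof.
move=> x0; have q0 : 0 < (pf_q E)%:R :> R by rewrite (lt_trans ltr01 pf_q_gt1).
rewrite log_absK // -powRD; last by apply/implyP => _; rewrite gt_eqF.
rewrite -[X in _ = (X <= _)](powRr0 (pf_q E)%:R) ler_pf_q_powR.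
by rewrite addrC subr_ge0.
Qed.

(** The last two clauses are the two inclusions between M' and the lattice spanned by the x_i e_i.
    Preimages in phi^* M are left out, so that for a constructed object a spanning family of phi^* N
    is enough to check them. *)
Definition adapted (M : phi_mod T) (I : finType) (e : I -> M) (c : I -> M -> O)
    (x : I -> T) : Prop :=
  [/\ is_basis e c, forall i, x i != 0,
    forall i, phi_image (x i *: bc_in incl (e i))
    & forall u : bc phi M, exists d : I -> O,
        pm_phi M (bc_in incl u) = \sum_i (vr_val (d i) * x i) *: bc_in incl (e i)].

Lemma vr_val_inj : injective (incl : O -> T).
Proof. exact: val_inj. Qed.

Lemma pm_phi_lincomb (M : phi_mod T) (I : finType) (a : I -> O) (u : I -> bc phi M) :
  pm_phi M (bc_in incl (\sum_i a i *: u i)) =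
    \sum_i vr_val (a i) *: pm_phi M (bc_in incl (u i)).
Proof.
rewrite (bc_in_lincomb incl) linear_sum; apply: eq_bigr => i _.
by rewrite linearZ.
Qed.

Lemma pm_phi_inj (M : phi_mod T) (u u' : bc phi M) :
  pm_phi M (bc_in incl u) = pm_phi M (bc_in incl u') -> u = u'.
Proof. by move/(bij_inj (pm_bij M)) => /(bc_in_inj vr_val_inj). Qed.

(** Elementary divisors of the matrix of phi_M. The basis [w] of phi^* M is returned as well because
    tensor, dual and power structures are computed on it. The free [n] allows the index type to be a
    sum of two ranks for the middle term of an exact sequence. *)
Lemma adapted_exists (M : phi_mod T) n : dim M = n ->
  exists (e : 'I_n -> M) c x (w : 'I_n -> bc phi M) d,
  [/\ adapted e c x, is_basis w d
    & forall i, pm_phi M (bc_in incl (w i)) = x i *: bc_in incl (e i)].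
Proof.
move=> <-.
pose A : 'M[T]_(dim M) := \matrix_(i, j) bc_coord (pm_phi M (bc_in incl (bc_in phi (@vb _ M i)))) j.
have [P [P' [Q [Q' [x [PP QQ PA]]]]]] := smith_diagonal (tl_abs T) A.
pose w i : bc phi M := \sum_j P i j *: bc_in phi (@vb _ M j).
pose e i : M := \sum_j Q i j *: @vb _ M j.
pose c i (y : M) : O := \sum_j (v2r y) 0 j * Q' j i.
pose d i (u : bc phi M) : O := \sum_j bc_coord u j * P' j i.
have ec : is_basis e c by apply: mx_basis QQ; exact: vb_basis.
have wd : is_basis w d by apply: mx_basis PP; exact: bc_basis_vb.
have xe i : pm_phi M (bc_in incl (w i)) = x 0 i *: bc_in incl (e i).
  rewrite pm_phi_lincomb /e (bc_in_lincomb incl).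
  apply: (basis_coord_inj (bc_basis_vb incl M)) => j.
  rewrite (basis_coordZ (bc_basis_vb incl M)) (basis_coord_sum (bc_basis_vb incl M)).
  rewrite (basis_coord_big (bc_basis_vb incl M)).
  have /matrixP /(_ i j) := PA; rewrite mul_diag_mx !mxE => <-.
  apply: eq_bigr => k _; rewrite (basis_coordZ (bc_basis_vb incl M)) !mxE.
  by [].
(* phi_M is injective and w_i is nonzero, having a coordinate equal to 1. *)
have x0 i : x 0 i != 0.
  apply/eqP => xi0; have := xe i; rewrite xi0 scale0r.
  rewrite -(linear0 (pm_phi M)) -(bc_in0 incl) => /pm_phi_inj wi0.
  case: (wd) => _ _ /(_ i i); rewrite wi0 eqxx (basis_coord0 wd) => /esym/eqP.
  by rewrite oner_eq0.
exists e, c, (fun i => x 0 i), w, d; split=> //; split=> // [i|u].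
  by exists (w i); rewrite xe.
exists (fun i => d i u); case: (wd) => _ /(_ u) {1}-> _; rewrite pm_phi_lincomb.
by apply: eq_bigr => i _; rewrite xe scalerA.
Qed.
End Adapted.

(** * The Hodge filtration in an adapted basis *)

Section Hodge.
Variables (R : realType) (p : nat) (E : padic_field R p).
Variables (K : perfectoid_ext E) (T : tilt K) (F : residue_field (tl_abs T)).

Local Notation O := (vring (tl_abs T)).
Local Notation phi := (@tl_frob R p E K T : {rmorphism O -> O}).
Local Notation incl := (@vr_val R T (tl_abs T) : {rmorphism O -> T}).
Local Notation res := (rf_map F).

Lemma hodge_adapted (M : phi_mod T) (I : finType) (e : I -> M) c x g :
  adapted e c x ->
  hodge F M g = coord_fil (fun i => bc_in res (e i)) (fun i => log_abs (x i)) g.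
Proof.
case=> ec x0 xe image_sub; have ecT := bc_basis incl ec; have ecF := bc_basis res ec.
apply/eqP; rewrite eqEsubv; apply/andP; split.
  apply: span_set_sub => _ [y [n [a [z [ag zim yE]]]] ->].
  (* Coordinate i of a vector of I(g) M' is at most q^(-g) |x_i|, which is less than 1 when g
     exceeds log_q |x_i|; it then reduces to 0. *)
  apply/(mem_coord_fil ecF) => i; rewrite ltNge le_log_abs // -ltNge => ig.
  rewrite (bc_fun_in res ec).
  apply/(rf_resP F).2; rewrite -(bc_fun_in incl ec) yE (basis_coord_big ecT).
  apply: le_lt_trans ig; apply: abs_sum_le => [|k _].
    by rewrite mulr_ge0 ?powR_ge0 ?abs_ge0.
  rewrite (basis_coordZ ecT) absM; apply: ler_pM; rewrite ?abs_ge0 //.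
  have [u ->] := zim k; have [d ->] := image_sub u.
  rewrite (basis_coord_sum ecT) absM ler_piMl ?abs_ge0 //; exact: vring_le1.
apply/span_subvP => _ /mapP[i + ->]; rewrite mem_enum inE => gi.
apply: mem_span_set; exists (e i) => //.
(* Conversely e_i = x_i^-1 (x_i e_i), and g <= log_q |x_i| puts x_i^-1 in I(g). *)
exists 1%N, (fun=> (x i)^-1), (fun=> x i *: bc_in incl (e i)); split=> [_|_|].
- have q0 : 0 < (pf_q E)%:R :> R by rewrite (lt_trans ltr01 (pf_q_gt1 E)).
  rewrite absV powRN lef_pV2 ?posrE ?powR_gt0 ?abs_gt0 //.
  by rewrite [leRHS]log_absK // ler_pf_q_powR.
- exact: xe.
by rewrite big_ord1 scalerA mulVf ?x0 // scale1r.
Qed.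

Lemma hodge_adapted_fun (M : phi_mod T) (I : finType) (e : I -> M) c x :
  adapted e c x ->
  hodge F M = coord_fil (fun i => bc_in res (e i)) (fun i => log_abs (x i)).
Proof. by move=> ad; apply: funext => g; exact: hodge_adapted ad. Qed.

Lemma mem_hodge (M : phi_mod T) (I : finType) (e : I -> M) c x g v :
  adapted e c x ->
  v \in hodge F M g <-> (forall i, log_abs (x i) < g -> bc_fun (f := res) (c i) v = 0).
Proof.
move=> ad; rewrite (hodge_adapted g ad).
by case: ad => ec _ _ _; apply: (mem_coord_fil (bc_basis res ec)).
Qed.

Lemma basis_in_hodge (M : phi_mod T) (I : finType) (e : I -> M) c x g i :
  adapted e c x -> g <= log_abs (x i) -> bc_in res (e i) \in hodge F M g.
Proof.
move=> ad gi; rewrite (hodge_adapted g ad); apply/memv_span/mapP.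
by exists i; rewrite ?mem_enum.
Qed.

Lemma hodge_filtration (M : phi_mod T) : is_filtration (hodge F M).
Proof.
have [e [c [x [w [d [ad _ _]]]]]] := adapted_exists (erefl (dim M)).
rewrite (hodge_adapted_fun ad).
by case: ad => ec _ _ _; apply: (coord_filtration (bc_basis res ec)).
Qed.

Lemma hodge_morphism (M N : phi_mod T) (h : 'Hom(M, N)) : phi_morphism h ->
  forall g, (bc_hom res h @: hodge F M g <= hodge F N g)%VS.
Proof.
move=> hphi g; apply/subvP => _ /memv_imgP[v /span_setP[s sP vs] ->].
have : bc_hom res h v \in (bc_hom res h @: <<s>>)%VS by exact: memv_img.
rewrite limg_span; apply: subvP; apply/span_subvP => _ /mapP[w /sP[y ysc ->] ->].
rewrite bc_homE; apply: mem_span_set; exists (h y) => //.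
case: ysc => n [a [z [ag zim yE]]].
exists n, a, (fun i => bc_hom incl h (z i)); split=> // [i|].
  have [u ->] := zim i; exists (bc_hom phi h u).
  by rewrite hphi bc_homE.
by rewrite -bc_homE yE linear_sum; apply: eq_bigr => i _; rewrite linearZ.
Qed.

End Hodge.

(** * Tensor products and duals *)

(** The existence half of the universal property produces the coordinate forms, and the uniqueness
    half shows that the products of basis vectors span. *)
Lemma tensor_basis (A : comNzRingType) (M1 M2 N : vectType A)
    (b : {bilinear M1 -> M2 -> N}) (I J : finType) (e1 : I -> M1) c1 (e2 : J -> M2) c2 :
  is_tensor b -> is_basis e1 c1 -> is_basis e2 c2 ->
  exists h, is_basis (fun ij : I * J => b (e1 ij.1) (e2 ij.2)) h.
Proof.
move=> tens ec1 ec2.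
have coordP (ij : I * J) : exists h : {linear N -> A^o},
    forall x y, h (b x y) = c1 ij.1 x * c2 ij.2 y.
  pose m (x : M1) (y : M2) : A^o := c1 ij.1 x * c2 ij.2 y.
  have ml u : linear (m^~ u).
    by move=> a x y; rewrite /m; case: ec1 => -> _ _; rewrite mulrDl -mulrA.
  have mr u : linear (m u).
    by move=> a x y; rewrite /m; case: ec2 => -> _ _; rewrite mulrDr mulrCA.
  pose B := HB.pack_for {bilinear M1 -> M2 -> A^o} m
    (bilinear_isBilinear.Build A M1 M2 A^o *:%R *:%R m (conj ml mr)).
  by have [[h hE] _] := tens _ B; exists h => x y; rewrite -hE.
have [h hE] := choice coordP.
exists (fun ij => h ij); split=> [ij a x y|x|ij kl]; first by rewrite linearP.
  (* [s] rebuilds a vector from its coordinates; it agrees with the identity on pure tensors, hence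
     everywhere. *)
  pose s (y : N) := \sum_ij h ij y *: b (e1 ij.1) (e2 ij.2).
  have slin : linear s.
    move=> a y z; rewrite /s scaler_sumr -big_split; apply: eq_bigr => ij _ /=.
    by rewrite linearP scalerDl scalerA.
  pose sl := HB.pack_for {linear N -> N} s (GRing.isLinear.Build A _ _ _ s slin).
  have [_ /(_ idfun sl)] := tens _ b.
  apply => {}x y /=; rewrite /s.
  have {1}-> : x = \sum_i c1 i x *: e1 i by case: ec1.
  have {1}-> : y = \sum_j c2 j y *: e2 j by case: ec2.
  rewrite linear_sumlz; under eq_bigr do rewrite linear_sumr.
  rewrite pair_bigA; apply: eq_bigr => -[i j] _ /=.
  by rewrite linearZl_LR linearZr_LR /= hE scalerA.
case: ij kl => i j [k l] /=; rewrite hE /=; case: ec1 => _ _ ->; case: ec2 => _ _ ->.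
by rewrite -natrM mulnb.
Qed.

Lemma dual_basis (A : comNzRingType) (M D : vectType A) (ev : {bilinear D -> M -> A^o})
    (I : finType) (e : I -> M) c : is_dual ev -> is_basis e c ->
  exists e' : I -> D, is_basis e' (fun i d => ev d (e i)) /\
    forall i x, ev (e' i) x = c i x.
Proof.
move=> dual ec.
have e'P i : exists d : D, forall x, ev d x = c i x.
  have [l lc] := basis_coord_lin ec i.
  by have [d [dE _]] := dual (linfun l); exists d => x; rewrite dE lfunE lc.
have [e' e'E] := choice e'P; exists e'; split=> //.
split=> [i a x y|d|i j].
- by rewrite linearPl.
- have [d0 [_ d0U]] := dual (linfun (ev d)).
  (* Both sides represent the form [ev d], and the representing element is unique. *)
  apply: etrans (esym (d0U d _)) (d0U _ _) => x; rewrite lfunE //= linear_sumlz.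
  have {2}-> : x = \sum_i c i x *: e i by case: ec.
  rewrite linear_sumr; apply: eq_bigr => i _.
  rewrite linearZl_LR linearZr_LR /= e'E.
  exact: mulrC.
by rewrite e'E eq_sym; case: ec.
Qed.

Section DualBases.
Variables (A S : comNzRingType) (f : {rmorphism A -> S}) (M D : vectType A).
Variables (ev : {bilinear D -> M -> A^o}) (I : finType).
Variables (e : I -> M) (c : I -> M -> A) (e' : I -> D).
Hypothesis ec : is_basis e c.
Hypothesis ec' : is_basis e' (fun i d => ev d (e i)).
Hypothesis e'E : forall i x, ev (e' i) x = c i x.

Lemma bc_form_dual_bases z v : bc_form (f := f) ev z v =
  \sum_i bc_fun (f := f) (fun d => ev d (e i)) z * bc_fun (f := f) (c i) v.
Proof.
have {1}-> : v = \sum_j bc_fun (f := f) (c j) v *: bc_in f (e j).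
  by case: (bc_basis f ec).
have {1}-> : z = \sum_j bc_fun (f := f) (fun d => ev d (e j)) z *: bc_in f (e' j).
  by case: (bc_basis f ec').
rewrite linear_sumlz; apply: eq_bigr => i _; rewrite linear_sumr (bigD1 i) //=.
rewrite linearZl_LR linearZr_LR /= bc_formE e'E big1 => [|j ji].
  by case: (ec) => _ _ ->; rewrite eqxx rmorph1 addr0 [_ *: 1]mulr1.
rewrite linearZl_LR linearZr_LR /= bc_formE e'E.
by case: (ec) => _ _ ->; rewrite eq_sym (negPf ji) rmorph0 !scaler0.
Qed.

Lemma bc_form_in_l i v : bc_form (f := f) ev (bc_in f (e' i)) v = bc_fun (f := f) (c i) v.
Proof.
rewrite bc_form_dual_bases (bigD1 i) //= big1 => [|j ji].
  by rewrite (bc_fun_in f ec') e'E; case: (ec) => _ _ ->; rewrite eqxx rmorph1 mul1r addr0.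
rewrite (bc_fun_in f ec') e'E; case: (ec) => _ _ ->.
by rewrite eq_sym (negPf ji) rmorph0 mul0r.
Qed.

Lemma bc_form_in_r i z :
  bc_form (f := f) ev z (bc_in f (e i)) = bc_fun (f := f) (fun d => ev d (e i)) z.
Proof.
rewrite bc_form_dual_bases (bigD1 i) //= big1 => [|j ji].
  by rewrite (bc_fun_in f ec); case: (ec) => _ _ ->; rewrite eqxx rmorph1 mulr1 addr0.
rewrite (bc_fun_in f ec); case: (ec) => _ _ ->.
by rewrite (negPf ji) rmorph0 mulr0.
Qed.

End DualBases.

Section TensorDual.
Variables (R : realType) (p : nat) (E : padic_field R p).
Variables (K : perfectoid_ext E) (T : tilt K) (F : residue_field (tl_abs T)).

Local Notation O := (vring (tl_abs T)).
Local Notation phi := (@tl_frob R p E K T : {rmorphism O -> O}).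
Local Notation incl := (@vr_val R T (tl_abs T) : {rmorphism O -> T}).
Local Notation res := (rf_map F).

(** phi_N sends w1_i (x) w2_j to x1_i x2_j (e1_i (x) e2_j), so the elementary divisors multiply.
    What remains is that these tensors span phi^* N. *)
Lemma adapted_tensor (M1 M2 N : phi_mod T) (b : {bilinear M1 -> M2 -> N})
    (I J : finType) (e1 : I -> M1) c1 x1 (e2 : J -> M2) c2 x2 w1 d1 w2 d2 :
  phi_tensor b -> adapted e1 c1 x1 -> adapted e2 c2 x2 ->
  is_basis w1 d1 -> (forall i, pm_phi M1 (bc_in incl (w1 i)) = x1 i *: bc_in incl (e1 i)) ->
  is_basis w2 d2 -> (forall j, pm_phi M2 (bc_in incl (w2 j)) = x2 j *: bc_in incl (e2 j)) ->
  exists h, adapted (fun ij : I * J => b (e1 ij.1) (e2 ij.2)) h (fun ij => x1 ij.1 * x2 ij.2).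
Proof.
move=> [tens bphi] [ec1 x10 _ _] [ec2 x20 _ _] wd1 we1 wd2 we2.
have [h bh] := tensor_basis tens ec1 ec2; exists h.
pose bphi' := bc_bil (f := phi) b.
have wE i j : pm_phi N (bc_in incl (bphi' (w1 i) (w2 j))) =
    (x1 i * x2 j) *: bc_in incl (b (e1 i) (e2 j)).
  rewrite -(bc_bilE incl bphi') bphi we1 we2 linearZl_LR linearZr_LR /=.
  by rewrite (bc_bilE incl b) scalerA.
split=> // [ij|ij|u]; first by rewrite mulf_neq0.
  by exists (bphi' (w1 ij.1) (w2 ij.2)); rewrite wE.
suff [d uE] : exists d : I * J -> O, u = \sum_ij d ij *: bphi' (w1 ij.1) (w2 ij.2).
  exists d; rewrite uE pm_phi_lincomb; apply: eq_bigr => ij _.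
  by rewrite wE scalerA.
have [_ /(_ u) -> _] := bc_basis phi bh.
(* The vectors 1 (x) (e1_i (x) e2_j) span phi^* N; each factor is expanded in the bases [w1] and
   [w2]. *)
exists (fun kl => \sum_ij bc_fun (f := phi) (h ij) u *
  (d1 kl.1 (bc_in phi (e1 ij.1)) * d2 kl.2 (bc_in phi (e2 ij.2)))).
under [RHS]eq_bigr do rewrite scaler_suml.
rewrite exchange_big; apply: eq_bigr => -[i j] _ /=.
under [RHS]eq_bigr do rewrite -scalerA.
rewrite -scaler_sumr; congr (_ *: _); rewrite -(bc_bilE phi b).
have {1}-> : bc_in phi (e1 i) = \sum_k d1 k (bc_in phi (e1 i)) *: w1 k by case: wd1.
have {1}-> : bc_in phi (e2 j) = \sum_k d2 k (bc_in phi (e2 j)) *: w2 k by case: wd2.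
rewrite linear_sumlz; under eq_bigr do rewrite linear_sumr.
rewrite pair_bigA; apply: eq_bigr => -[k l] _ /=.
by rewrite linearZl_LR linearZr_LR /= scalerA.
Qed.

Lemma hodge_tensor (M1 M2 N : phi_mod T) (b : {bilinear M1 -> M2 -> N}) :
  phi_tensor b -> forall g,
  hodge F N g = fil_tensor (bc_bil (f := res) b) (hodge F M1) (hodge F M2) g.
Proof.
move=> bt g.
have [e1 [c1 [x1 [w1 [d1 [ad1 wd1 we1]]]]]] := adapted_exists (erefl (dim M1)).
have [e2 [c2 [x2 [w2 [d2 [ad2 wd2 we2]]]]]] := adapted_exists (erefl (dim M2)).
have [h ad] := adapted_tensor bt ad1 ad2 wd1 we1 wd2 we2.
have [ec1 x10 _ _] := ad1; have [ec2 x20 _ _] := ad2.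
apply/eqP; rewrite eqEsubv; apply/andP; split.
  rewrite (hodge_adapted F g ad); apply/span_subvP => _ /mapP[[i j] + ->] /=.
  rewrite mem_enum inE /= log_absM // => gij; apply: mem_span_set.
  (* The two degrees must add up to g exactly, so the whole slack is left to the second factor. *)
  exists (log_abs (x1 i)), (g - log_abs (x1 i)), (bc_in res (e1 i)), (bc_in res (e2 j)).
  split; [by rewrite addrC subrK| | |by rewrite bc_bilE].
    exact: basis_in_hodge ad1 _.
  by apply: basis_in_hodge ad2 _; rewrite lerBlDl.
apply: span_set_sub => _ [g1 [g2 [u [v [gE /(mem_hodge _ _ ad1) ug /(mem_hodge _ _ ad2) vg ->]]]]].
have [_ /(_ u) -> _] := bc_basis res ec1; have [_ /(_ v) -> _] := bc_basis res ec2.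
rewrite linear_sumlz; apply: memv_suml => i _; rewrite linear_sumr; apply: memv_suml => j _.
rewrite linearZl_LR linearZr_LR /=.
have [/ug ->|gi] := ltP (log_abs (x1 i)) g1; first by rewrite scale0r mem0v.
have [/vg ->|gj] := ltP (log_abs (x2 j)) g2; first by rewrite scale0r scaler0 mem0v.
rewrite bc_bilE !memvZ //; apply: (basis_in_hodge F (i := (i, j)) ad).
by rewrite /= log_absM // -gE lerD.
Qed.


Lemma adapted_dual (M D : phi_mod T) (ev : {bilinear D -> M -> O^o})
    (I : finType) (e : I -> M) c x w d :
  phi_dual ev -> adapted e c x -> is_basis w d ->
  (forall i, pm_phi M (bc_in incl (w i)) = x i *: bc_in incl (e i)) ->
  exists e' : I -> D, adapted e' (fun i d => ev d (e i)) (fun i => (x i)^-1) /\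
    forall i y, ev (e' i) y = c i y.
Proof.
move=> [dual dphi] [ec x0 _ _] wd we.
have [e' [ec' e'E]] := dual_basis dual ec; exists e'; split=> //.
pose form := bc_form (f := phi) ev.
(* The basis of phi^* D dual to [w], written in the basis dual to (e_j). *)
pose w' i : bc phi D := \sum_j d i (bc_in phi (e j)) *: bc_in phi (e' j).
have w'E i v : form (w' i) v = d i v.
  rewrite /form /w' linear_sumlz.
  have {2}-> : v = \sum_j bc_fun (f := phi) (c j) v *: bc_in phi (e j).
    by case: (bc_basis phi ec).
  rewrite (basis_coord_big wd); apply: eq_bigr => j _.
  rewrite linearZl_LR /= (bc_form_in_l ec ec' e'E) (basis_coordZ wd).
  exact: mulrC.
have formI : forall u u', (forall v, form u v = form u' v) -> u = u'.
  move=> u u' uu; apply: (basis_coord_inj (bc_basis phi ec')) => i.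
  by rewrite -!(bc_form_in_r ec ec' e'E); exact: uu.
have ecT' := bc_basis incl ec'.
have we' i : pm_phi D (bc_in incl (w' i)) = (x i)^-1 *: bc_in incl (e' i).
  apply: (basis_coord_inj ecT') => j.
  rewrite (basis_coordZ ecT'); apply: (mulfI (x0 j)); rewrite -(bc_form_in_r ec ec' e'E).
  (* The factor x_j turns e_j into phi_M(w_j), against which compatibility of the pairing with
     Frobenius applies; the result is delta_ij. *)
  have -> : x j * bc_form (f := incl) ev (pm_phi D (bc_in incl (w' i))) (bc_in incl (e j)) =
      bc_form (f := incl) ev (pm_phi D (bc_in incl (w' i))) (pm_phi M (bc_in incl (w j))).
    by rewrite we linearZr_LR.
  rewrite dphi (bc_formE incl (bc_form (f := phi) ev)).
  apply: etrans (congr1 (fun z : O => vr_val z) (w'E i (w j))) _.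
  case: wd => _ _ ->; case: ecT' => _ _ ->; rewrite eq_sym.
  by case: eqP => [->|_]; rewrite ?mulr0 // mulr1 divff.
split=> // [i|i|u]; first by rewrite invr_eq0.
  by exists (w' i); rewrite we'.
exists (fun i => form u (w i)).
have {1}-> : u = \sum_i form u (w i) *: w' i.
  apply: formI => v; rewrite {2}/form linear_sumlz.
  have {1}-> : v = \sum_i d i v *: w i by case: wd.
  rewrite /form linear_sumr; apply: eq_bigr => i _.
  rewrite linearZl_LR linearZr_LR /=.
 apply: etrans (mulrC _ _) (congr1 _ (esym (w'E i v))).
rewrite pm_phi_lincomb; apply: eq_bigr => i _.
by rewrite we' scalerA.
Qed.

Lemma hodge_dual (M D : phi_mod T) (ev : {bilinear D -> M -> O^o}) :
  phi_dual ev -> forall g (d : red F D),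
  d \in hodge F D g <->
  forall x : red F M, x \in fil_gt (hodge F M) (- g) -> bc_form (f := res) ev d x = 0.
Proof.
move=> evd g u.
have [e [c [x [w [d [ad wd we]]]]]] := adapted_exists (erefl (dim M)).
have [e' [ad' e'E]] := adapted_dual evd ad wd we.
have [ec x0 _ _] := ad; have [ec' _ _ _] := ad'.
have fE := bc_form_dual_bases ec ec' e'E.
rewrite (hodge_adapted_fun F ad) (fil_gt_coord (bc_basis res ec)).
split=> [/(mem_hodge _ _ ad') ug v /(mem_coord_space (bc_basis res ec)) vg|h].
  rewrite fE big1 // => i _; have [gi|gi] := boolP (- g < log_abs (x i)).
    by rewrite ug ?mul0r // log_absV // ltrNl.
  by rewrite vg ?mulr0.
apply/(mem_hodge _ _ ad') => i; rewrite log_absV // ltrNl => gi.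
have /h : bc_in res (e i) \in coord_space (fun i => bc_in res (e i)) [pred i | - g < log_abs (x i)].
  by apply/memv_span/mapP; exists i; rewrite ?mem_enum.
by rewrite (bc_form_in_r ec ec' e'E).
Qed.

End TensorDual.

(** * Symmetric and exterior powers *)

Section IndexOrbits.
Variables (k : nat) (I : finType).
Implicit Types a b : {ffun 'I_k -> I}.

Definition perm_equiv a b := [exists s : {perm 'I_k}, b == [ffun i => a (s i)]].

Lemma perm_equivP a b :
  reflect (exists s : {perm 'I_k}, b = [ffun i => a (s i)]) (perm_equiv a b).
Proof. by apply: (iffP existsP) => -[s /eqP h]; exists s. Qed.

Lemma perm_equiv_refl a : perm_equiv a a.
Proof. by apply/perm_equivP; exists 1%g; apply/ffunP => i; rewrite ffunE perm1. Qed.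

Lemma perm_equiv_sym a b : perm_equiv a b = perm_equiv b a.
Proof.
suff impl a' b' : perm_equiv a' b' -> perm_equiv b' a' by apply/idP/idP; exact: impl.
move=> /perm_equivP[s ->]; apply/perm_equivP; exists (s^-1)%g; apply/ffunP => i.
by rewrite !ffunE permKV.
Qed.

Lemma perm_equiv_trans : transitive perm_equiv.
Proof.
move=> b a d /perm_equivP[s ->] /perm_equivP[t ->]; apply/perm_equivP.
by exists (t * s)%g; apply/ffunP => i; rewrite !ffunE permM.
Qed.

(** [choose] depends only on the predicate up to extensional equality, so the representative is
    constant on orbits. Orbits are multisets of indices, that is monomials of degree k. *)
Definition orbit_rep a := choose (perm_equiv a) a.

Lemma orbit_repP a : perm_equiv a (orbit_rep a).
Proof. exact: (chooseP (perm_equiv_refl a)). Qed.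

Lemma eq_orbit_rep a b : perm_equiv a b -> orbit_rep a = orbit_rep b.
Proof.
move=> ab; rewrite /orbit_rep (choose_id (y0 := b)) ?perm_equiv_refl //.
  apply: eq_choose => d; apply/idP/idP; last exact: perm_equiv_trans.
  by apply: perm_equiv_trans; rewrite perm_equiv_sym.
Qed.

Lemma orbit_rep_id a : orbit_rep (orbit_rep a) = orbit_rep a.
Proof. by rewrite -(eq_orbit_rep (orbit_repP a)). Qed.

End IndexOrbits.

(** The scalar is the signature, but its mere existence is enough later. Transpositions are treated
    by expanding m at u i + u j in both slots; products of transpositions give the rest. *)
Lemma alternating_perm (A : comNzRingType) (k : nat) (M N : lmodType A)
    (m : {ffun 'I_k -> M} -> N) (s : {perm 'I_k}) :
  multilinear m -> alternating_map m ->
  exists a : A, forall u : {ffun 'I_k -> M}, m [ffun i => u (s i)] = a *: m u.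
Proof.
move=> mm alt.
have swap (u : {ffun 'I_k -> M}) i j : i != j -> m [ffun l => u (tperm i j l)] = - m u.
  move=> ij; pose g x y := m (fupd (fupd u i x) j y).
  have gE x y z : g (x + y) z = g x z + g y z.
    rewrite /g.
    have E t : fupd (fupd u i t) j z = fupd (fupd u j z) i t.
      by apply/ffunP => l; rewrite !ffunE; case: (eqVneq l j) => [->|//];
         rewrite eq_sym (negPf ij).
    by rewrite !E -{1}(scale1r x) mm scale1r.
  have gE' x y z : g z (x + y) = g z x + g z y.
    by rewrite /g -{1}(scale1r x) mm scale1r.
  have g0 x : g x x = 0.
    by apply: (alt _ i j) => //; rewrite !ffunE eqxx (negPf ij) eqxx.
  have -> : m u = g (u i) (u j).
    congr (m _); apply/ffunP => l; rewrite !ffunE.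
    by case: eqP => [->|_] //; case: eqP => [->|].
  have -> : [ffun l => u (tperm i j l)] = fupd (fupd u i (u j)) j (u i).
    apply/ffunP => l; rewrite !ffunE; case: tpermP => [->|->|].
    - by rewrite (negPf ij) eqxx.
    - by rewrite eqxx.
    - by move=> /eqP/negPf -> /eqP/negPf ->.
  have := g0 (u i + u j); rewrite gE !gE' !g0 add0r addr0 => /eqP.
  by rewrite addrC addr_eq0 => /eqP.
have [ts -> tsP] := prod_tpermP s.
elim: ts tsP => [_|[i j] ts IHts /= /andP[ij /IHts[a aE]]].
  exists 1 => u; rewrite big_nil scale1r; congr (m _).
  by apply/ffunP => i; rewrite ffunE perm1.
exists (- a) => u; rewrite big_cons scaleNr -aE -(swap _ _ _ ij); congr (m _).
by apply/ffunP => l; rewrite !ffunE permM.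
Qed.

(** * Monomial bases of symmetric and exterior powers *)

Section PowerBases.
Variables (A : comNzRingType) (k : nat) (M N : vectType A) (m : {ffun 'I_k -> M} -> N).
Variables (I : finType) (e : I -> M) (c : I -> M -> A).
Hypothesis ec : is_basis e c.
Local Notation tuple_of a := [ffun i => e (a i)].

(** Rebuilding a vector from the forms h is an endomorphism of N that agrees with the identity on m
    of basis tuples, hence on all values of m; uniqueness in the universal property concludes. *)
Lemma universal_basis (J : finType) (r : J -> {ffun 'I_k -> I}) (h : J -> {linear N -> A^o}) :
  multilinear m ->
  (forall s s' : {linear N -> N}, (forall u, s (m u) = s' (m u)) -> s =1 s') ->
  (forall i j, h i (m (tuple_of (r j))) = (i == j)%:R) ->
  (forall a : {ffun 'I_k -> I},
    m (tuple_of a) = \sum_j h j (m (tuple_of a)) *: m (tuple_of (r j))) ->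
  is_basis (fun j => m (tuple_of (r j))) (fun j => h j).
Proof.
move=> mm uniq hE gen; split=> [j a x y|x|i j]; [by rewrite linearP| |exact: hE].
pose s (y : N) := \sum_j h j y *: m (tuple_of (r j)).
have slin : linear s.
  move=> a y z; rewrite /s scaler_sumr -big_split; apply: eq_bigr => j _ /=.
  by rewrite linearP scalerDl scalerA.
pose sl := HB.pack_for {linear N -> N} s (GRing.isLinear.Build A _ _ _ s slin).
apply: (uniq idfun sl) => u /=.
apply: (multi_semilinear_ext (f := idfun) ec (m' := fun u => s (m u)) mm) => [|a].
  by move=> w i a y z; rewrite mm slin.
exact: gen.
Qed.

(** Monomials, one for each orbit. The second assertion says that a tuple has a nonzero coordinate
    only along its own orbit; products of elementary divisors are constant on orbits. *)
Lemma sym_power_basis : is_sym_power m ->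
  exists J : finType, exists r : J -> {ffun 'I_k -> I}, exists h : J -> N -> A,
    is_basis (fun j => m (tuple_of (r j))) h /\
    forall j (a : {ffun 'I_k -> I}), h j (m (tuple_of a)) != 0 ->
      exists s : {perm 'I_k}, a = [ffun i => r j (s i)].
Proof.
case=> mm msym univ.
pose J := {a : {ffun 'I_k -> I} | orbit_rep a == a}.
have funP (j : J) : exists h : {linear N -> A^o}, forall u,
    h (m u) = \sum_(a | perm_equiv (val j) a) \prod_i c (a i) (u i).
  (* The coefficient of a monomial in a product of vectors. Summing over distinct tuples of the
     orbit, not over permutations, gives the value 1 on that monomial without dividing by a
     factorial. *)
  pose l (u : {ffun 'I_k -> M}) : A^o := \sum_(a | perm_equiv (val j) a) (\prod_i c (a i) (u i)).
  have lmul : multilinear l.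
    have lE (u : {ffun 'I_k -> M}) : l u =
        \sum_(a | perm_equiv (val j) a) (\prod_i c (a i) (u i)) *: (1 : A^o).
      by apply: eq_bigr => a _; rewrite [_ *: 1]mulr1.
    move=> u i z x y; rewrite !lE.
    refine (@multi_semilinear_bigsum A A idfun k M A^o _ _ _
      (fun (a : {ffun 'I_k -> I}) (u : {ffun 'I_k -> M}) => (\prod_i c (a i) (u i)) *: (1 : A^o))
      _ u i z x y) => a.
    apply: (@multi_semilinear_prod A A idfun k M A^o (fun i => c (a i))).
    by move=> l0; case: ec => clin _ _; exact: clin.
  have lsym : symmetric_map l.
    move=> u s; rewrite /l.
    rewrite (reindex_inj (h := fun a : {ffun 'I_k -> I} => [ffun i => a (s i)])) /=.
      apply: eq_big => [a|a _]; last first.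
        rewrite [RHS](reindex_inj (@perm_inj _ s)); apply: eq_bigr => i _.
        by rewrite !ffunE.
      have aE : perm_equiv a [ffun i => a (s i)] by apply/perm_equivP; exists s.
      apply/idP/idP => h; first by apply: perm_equiv_trans h _; rewrite perm_equiv_sym.
      exact: perm_equiv_trans aE.
    move=> a b /ffunP ab; apply/ffunP => i; have := ab ((s^-1)%g i).
    by rewrite !ffunE permKV.
  by have [[h hE] _] := univ _ l lmul lsym; exists h => u; rewrite -hE.
have [h hE] := choice funP.
have hE' j (a : {ffun 'I_k -> I}) : h j (m (tuple_of a)) = (perm_equiv (val j) a)%:R.
  rewrite hE; under eq_bigr do rewrite (prod_coord_basis ec).
  have [ja|ja] := boolP (perm_equiv (val j) a).
    rewrite (bigD1 a) //= eqxx big1 ?addr0 // => b /andP[_ /negPf ->].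
    by [].
  rewrite big1 // => b jb; case: eqP => // ba.
  by rewrite -ba jb in ja.
have JE (i j : J) : perm_equiv (val i) (val j) -> i = j.
  move=> /eq_orbit_rep ij; apply/val_inj.
  by rewrite -(eqP (valP i)) -(eqP (valP j)).
exists J, (fun j => val j), (fun j => h j); split; last first.
  by move=> j a; rewrite hE'; case: perm_equivP => // _; rewrite eqxx.
apply: universal_basis => //; first by move=> s s'; case: (univ _ m mm msym) => _; apply.
  move=> i j; rewrite hE'; case: eqVneq => [->|ij]; first by rewrite perm_equiv_refl.
  by rewrite (negPf (_ : ~~ perm_equiv _ _)) //; apply/negP => /JE /eqP; rewrite (negPf ij).
move=> a; have repP : orbit_rep (orbit_rep a) == orbit_rep a by rewrite orbit_rep_id.
pose j0 : J := exist _ (orbit_rep a) repP.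
rewrite (bigD1 j0) //= hE' big1 => [|j jj0].
  rewrite /= perm_equiv_sym orbit_repP scale1r addr0.
  have /perm_equivP[s ->] := orbit_repP a.
  have -> : tuple_of [ffun i => a (s i)] = [ffun i => (tuple_of a) (s i)].
    by apply/ffunP => i; rewrite !ffunE.
  by rewrite msym.
rewrite hE' (negPf (_ : ~~ perm_equiv _ _)) ?scale0r //; apply: contra jj0 => ja.
by apply/eqP/JE; apply: perm_equiv_trans ja _; exact: orbit_repP.
Qed.

(** Only orbits of injective tuples contribute, and the coordinate forms are minors. Orbit
    representatives replace increasing tuples, as I carries no order. *)
Lemma ext_power_basis : is_ext_power m ->
  exists J : finType, exists r : J -> {ffun 'I_k -> I}, exists h : J -> N -> A,
    is_basis (fun j => m (tuple_of (r j))) h /\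
    forall j (a : {ffun 'I_k -> I}), h j (m (tuple_of a)) != 0 ->
      exists s : {perm 'I_k}, a = [ffun i => r j (s i)].
Proof.
case=> mm malt univ.
pose J := {a : {ffun 'I_k -> I} | (orbit_rep a == a) && injectiveb a}.
have funP (j : J) : exists h : {linear N -> A^o}, forall u,
    h (m u) = \det (\matrix_(i, l) c (val j l) (u i)).
  pose l (u : {ffun 'I_k -> M}) : A^o := \det (\matrix_(i, l) c (val j l) (u i)).
  have lmul : multilinear l.
    have lE (u : {ffun 'I_k -> M}) : l u =
        \sum_(s : 'S_k) (\prod_i c (val j (s i)) (u i)) *: ((-1) ^+ s : A^o).
      apply: eq_bigr => s _; rewrite mulrC; congr (_ * _).
      by apply: eq_bigr => i _; rewrite mxE.
    move=> u i z x y; rewrite !lE.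
    refine (@multi_semilinear_bigsum A A idfun k M A^o _ _ predT
      (fun (s : 'S_k) (u : {ffun 'I_k -> M}) =>
        (\prod_i c (val j (s i)) (u i)) *: ((-1) ^+ s : A^o))
      _ u i z x y) => s.
    apply: (@multi_semilinear_prod A A idfun k M A^o (fun i => c (val j (s i)))).
    by move=> l0; case: ec => clin _ _; exact: clin.
  have lalt : alternating_map l.
    by move=> u i1 i2 ii uu; apply: (determinant_alternate ii) => i; rewrite !mxE uu.
  by have [[h hE] _] := univ _ l lmul lalt; exists h => u; rewrite -hE.
have [h hE] := choice funP.
have hE0 j (a : {ffun 'I_k -> I}) : h j (m (tuple_of a)) != 0 -> perm_equiv (val j) a.
  rewrite hE; apply: contraR => ja; rewrite /determinant big1 // => s _.
  have [i ai] : exists i, a i != val j (s i).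
    apply/existsP; rewrite -negb_forall; apply: contra ja => /forallP h0.
    apply/perm_equivP; exists s; apply/ffunP => i; rewrite ffunE; exact/eqP.
  rewrite (bigD1 i) //= mxE ffunE; case: ec => _ _ ->.
  by rewrite eq_sym (negPf ai) mul0r mulr0.
have JE (i j : J) : perm_equiv (val i) (val j) -> i = j.
  move=> /eq_orbit_rep ij; apply/val_inj.
  by case/andP: (valP i) => /eqP <- _; case/andP: (valP j) => /eqP <- _.
have hE1 (i j : J) : h i (m (tuple_of (val j))) = (i == j)%:R.
  case: eqVneq => [->|ij]; last by apply/eqP; apply: contraR ij => /hE0 /JE ->.
  rewrite hE -(det1 A k); congr (\det _); apply/matrixP => l l'; rewrite !mxE ffunE.
  case: ec => _ _ ->; rewrite eq_sym; congr ((nat_of_bool _)%:R).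
  by case/andP: (valP j) => _ /injectiveP /inj_eq ->.
exists J, (fun j => val j), (fun j => h j); split; last by move=> j a /hE0 /perm_equivP.
apply: universal_basis => //; first by move=> s s'; case: (univ _ m mm malt) => _; apply.
move=> a; have [ainj|] := boolP (injectiveb a); last first.
  move=> /injectivePn[i [i' ii' aa]].
  have -> : m (tuple_of a) = 0 by apply: (malt _ i i') => //; rewrite !ffunE aa.
  by rewrite big1 // => j _; rewrite linear0 scale0r.
have repP : (orbit_rep (orbit_rep a) == orbit_rep a) && injectiveb (orbit_rep a).
  rewrite orbit_rep_id eqxx; apply/injectiveP.
  have /perm_equivP[s ->] := orbit_repP a => i i'; rewrite !ffunE.
  by move/(injectiveP _ ainj)/perm_inj.
pose j0 : J := exist _ (orbit_rep a) repP.
have /perm_equivP[s sE] : perm_equiv (orbit_rep a) a by rewrite perm_equiv_sym orbit_repP.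
have [z zE] := alternating_perm s mm malt.
have -> : m (tuple_of a) = z *: m (tuple_of (val j0)).
  rewrite -zE; congr (m _); apply/ffunP => i; rewrite {1}sE !ffunE //.
have h0 j : h j (m (tuple_of (orbit_rep a))) = (j == j0)%:R := hE1 j j0.
rewrite (bigD1 j0) //= linearZ /= h0 eqxx big1 ?addr0 => [|j jj0].
  by rewrite [z *: 1]mulr1.
by rewrite linearZ /= h0 (negPf jj0) scaler0 scale0r.
Qed.

End PowerBases.

(** * The Hodge filtration of a power *)

Section Powers.
Variables (R : realType) (p : nat) (E : padic_field R p).
Variables (K : perfectoid_ext E) (T : tilt K) (F : residue_field (tl_abs T)).

Local Notation O := (vring (tl_abs T)).
Local Notation phi := (@tl_frob R p E K T : {rmorphism O -> O}).
Local Notation incl := (@vr_val R T (tl_abs T) : {rmorphism O -> T}).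
Local Notation res := (rf_map F).

Variables (k : nat) (M N : phi_mod T) (m : {ffun 'I_k -> M} -> N).
Hypotheses (mm : multilinear m) (mphi : phi_compat_power m).

(** phi_N sends the power of a w-tuple to the product of its elementary divisors times the power of
    the e-tuple. The argument is common to both kinds of powers: all it needs is that coordinates
    respect orbits. *)
Lemma adapted_power (I J : finType) (e : I -> M) c x w d
    (r : J -> {ffun 'I_k -> I}) h :
  adapted e c x -> is_basis w d ->
  (forall i, pm_phi M (bc_in incl (w i)) = x i *: bc_in incl (e i)) ->
  is_basis (fun j => m [ffun i => e (r j i)]) h ->
  (forall j (a : {ffun 'I_k -> I}), h j (m [ffun i => e (a i)]) != 0 ->
      exists s : {perm 'I_k}, a = [ffun i => r j (s i)]) ->
  adapted (fun j => m [ffun i => e (r j i)]) h (fun j => \prod_i x (r j i)).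
Proof.
move=> [ec x0 _ _] wd we mh hperm; have ecT := bc_basis incl ec.
pose mw (a : {ffun 'I_k -> I}) := bc_mul (f := phi) m [ffun i => w (a i)].
have mwE a : pm_phi N (bc_in incl (mw a)) =
    (\prod_i x (a i)) *: bc_in incl (m [ffun i => e (a i)]).
  rewrite /mw -(bc_mulE incl _ (bc_mul_multilinear (f := phi) m)) mphi.
  rewrite -(bc_mulE incl _ mm).
  rewrite -(multilinearZ ecT (fun i => x (a i)) _ (bc_mul_multilinear (f := incl) m)).
  by congr (bc_mul _ _); apply/ffunP => i; rewrite !ffunE we.
split=> // [j|j|u]; first by apply/prodf_neq0.
  by exists (mw (r j)); rewrite mwE.
have [G uG] : exists G : {ffun 'I_k -> I} -> O, u = \sum_a G a *: mw a.
  exists (fun a => \sum_j bc_fun (f := phi) (h j) u *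
    \prod_i d (a i) ([ffun i => bc_in phi ([ffun i => e (r j i)] i)] i)).
  under eq_bigr do rewrite scaler_suml; rewrite exchange_big /=.
  have [_ /(_ u) {1}-> _] := bc_basis phi mh; apply: eq_bigr => j _.
  rewrite -(bc_mulE phi _ mm) (multilinear_expand wd _ (bc_mul_multilinear (f := phi) m)).
  by rewrite scaler_sumr; apply: eq_bigr => a _; rewrite scalerA.
exists (fun j => \sum_a G a * h j (m [ffun i => e (a i)])).
rewrite uG pm_phi_lincomb.
under [RHS]eq_bigr do rewrite rmorph_sum mulr_suml scaler_suml.
rewrite exchange_big; apply: eq_bigr => a _ /=.
rewrite mwE; have [_ /(_ (m [ffun i => e (a i)])) {1}-> _] := mh.
rewrite (bc_in_lincomb incl) !scaler_sumr; apply: eq_bigr => j _; rewrite !scalerA.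
congr (_ *: _); rewrite -!mulrA; congr (_ * _); rewrite mulrC.
(* A nonzero coefficient makes a a rearrangement of r j, so the two products of elementary divisors
   agree. *)
have [->|/hperm[s ->]] := eqVneq (h j (m [ffun i => e (a i)])) 0.
  by rewrite rmorph0 !mul0r.
congr (_ * _); rewrite [RHS](reindex_inj (@perm_inj _ s)).
by apply: eq_bigr => i _; rewrite ffunE.
Qed.

Lemma hodge_power (I J : finType) (e : I -> M) c x w d
    (r : J -> {ffun 'I_k -> I}) h g :
  adapted e c x -> is_basis w d ->
  (forall i, pm_phi M (bc_in incl (w i)) = x i *: bc_in incl (e i)) ->
  is_basis (fun j => m [ffun i => e (r j i)]) h ->
  (forall j (a : {ffun 'I_k -> I}), h j (m [ffun i => e (a i)]) != 0 ->
      exists s : {perm 'I_k}, a = [ffun i => r j (s i)]) ->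
  hodge F N g = fil_power (bc_mul (f := res) m) (hodge F M) g.
Proof.
move=> ad wd we mh hperm; have adN := adapted_power ad wd we mh hperm.
have [ec x0 _ _] := ad; have ecF := bc_basis res ec.
have bmul := bc_mul_multilinear (f := res) m.
apply/eqP; rewrite eqEsubv; apply/andP; split.
  rewrite (hodge_adapted F g adN); apply/span_subvP => _ /mapP[j + ->].
  rewrite mem_enum inE /= log_abs_prod // => gj; apply: mem_span_set.
  exists (fun i => log_abs (x (r j i))), [ffun i => bc_in res (e (r j i))]; split=> // [i|].
    by rewrite ffunE; exact: basis_in_hodge ad _.
  by rewrite -(bc_mulE res _ mm); congr (bc_mul _ _); apply/ffunP => i; rewrite !ffunE.
apply: span_set_sub => _ [g_ [u [gg ug ->]]].
rewrite (multilinear_expand ecF _ bmul); apply: memv_suml => a _.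
(* If some g_ i exceeds the jump of the i-th index, the corresponding coordinate of u i vanishes and
   kills the term. *)
have [/forallP ga|] := boolP [forall i, g_ i <= log_abs (x (a i))]; last first.
  rewrite negb_forall => /existsP[i]; rewrite -ltNge => ai.
  rewrite (bigD1 i) //=; have /(mem_hodge _ _ ad) -> := ug i => //.
  by rewrite mul0r scale0r mem0v.
apply: memvZ.
have -> : [ffun i => bc_in res (e (a i))] = [ffun i => bc_in res ([ffun i => e (a i)] i)].
  by apply/ffunP => i; rewrite !ffunE.
rewrite (bc_mulE res _ mm); have [_ /(_ (m [ffun i => e (a i)])) -> _] := mh.
rewrite (bc_in_lincomb res); apply: memv_suml => j _.
have [->|/hperm[s aE]] := eqVneq (h j (m [ffun i => e (a i)])) 0.
  by rewrite rmorph0 scale0r mem0v.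
apply: memvZ; apply: (basis_in_hodge F adN); apply: (le_trans gg).
rewrite log_abs_prod // [leRHS](reindex_inj (@perm_inj _ s)).
by apply: ler_sum => i _; have := ga i; rewrite aE ffunE.
Qed.

End Powers.

Section SymExt.
Variables (R : realType) (p : nat) (E : padic_field R p).
Variables (K : perfectoid_ext E) (T : tilt K) (F : residue_field (tl_abs T)).
Local Notation res := (rf_map F).

Lemma hodge_sym_power (k : nat) (M N : phi_mod T) (m : {ffun 'I_k -> M} -> N) :
  phi_sym_power m -> forall g,
  hodge F N g = fil_power (bc_mul (f := res) m) (hodge F M) g.
Proof.
move=> [msym mphi] g; have [mm _ _] := msym.
have [e [c [x [w [d [ad wd we]]]]]] := adapted_exists (erefl (dim M)).
have [ec _ _ _] := ad.
have [J [r [h [mh hperm]]]] := sym_power_basis ec msym.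
exact: hodge_power ad wd we mh hperm.
Qed.

Lemma hodge_ext_power (k : nat) (M N : phi_mod T) (m : {ffun 'I_k -> M} -> N) :
  phi_ext_power m -> forall g,
  hodge F N g = fil_power (bc_mul (f := res) m) (hodge F M) g.
Proof.
move=> [mext mphi] g; have [mm _ _] := mext.
have [e [c [x [w [d [ad wd we]]]]]] := adapted_exists (erefl (dim M)).
have [ec _ _ _] := ad.
have [J [r [h [mh hperm]]]] := ext_power_basis ec mext.
exact: hodge_power ad wd we mh hperm.
Qed.

End SymExt.

(** * Exact sequences *)

Section Majorization.
Variable R : realType.
Implicit Types s t : seq R.

(* Hardy-Littlewood-Polya: majorization is tested on the convex functions
   x |-> max 0 (x - c), with c among the entries of t. *)
Lemma type_le_of_excess s t :
  size s = size t -> sorted (fun x y => y <= x) t ->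
  \sum_(x <- s) x = \sum_(x <- t) x ->
  (forall c, c \in t ->
    \sum_(x <- s) Num.max 0 (x - c) <= \sum_(x <- t) Num.max 0 (x - c)) ->
  type_le s t.
Proof.
move=> st tS sumst ex; split=> // -[|k]; first by rewrite !take0 !big_nil.
(* With the threshold at the last of the first k+1 entries of t, the excess of t is exactly the sum
   of x - c over these entries, while that of s is at least its analogue. *)
rewrite st => kt; pose c := nth 0 t k.
have geT : transitive (fun x y : R => y <= x) by move=> y x z xy yz; exact: le_trans xy.
have tnth i j : (i <= j < size t)%N -> nth 0 t j <= nth 0 t i.
  have ger : reflexive (fun x y : R => y <= x) by move=> x /=.
  move=> /andP[ij jt]; apply: (sorted_leq_nth geT ger 0 tS) => //.
  by rewrite inE; exact: leq_ltn_trans ij jt.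
have shift u : size u = size t ->
    \sum_(x <- take k.+1 u) x = \sum_(x <- take k.+1 u) (x - c) + c *+ k.+1.
  move=> us; rewrite sumrB big_const_seq count_predT size_takel ?us //.
  by rewrite iter_addr_0 subrK.
rewrite !shift // lerD2r.
have max_ge0 (x : R) : 0 <= Num.max 0 x by rewrite le_max lexx.
apply: (@le_trans _ _ (\sum_(x <- s) Num.max 0 (x - c))).
  rewrite -[in leRHS](cat_take_drop k.+1 s) big_cat /= ler_wpDr //.
    exact: sumr_ge0.
  by apply: ler_sum => x _; rewrite le_max lexx orbT.
apply: (le_trans (ex c (mem_nth _ kt))).
rewrite -[in leLHS](cat_take_drop k.+1 t) big_cat /= [X in _ + X]big1_seq ?addr0.
  rewrite big_seq [leRHS]big_seq; apply: ler_sum => x /(nthP 0)[j].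
  rewrite size_takel // => jk <-; rewrite nth_take // max_r // subr_ge0.
  by apply: tnth; rewrite -ltnS jk.
move=> x /= /(nthP 0)[j]; rewrite size_drop => jt <-; rewrite nth_drop max_l // subr_le0.
by apply: tnth; rewrite -ltn_subRL jt andbT addSn ltnW // ltnS leq_addr.
Qed.

(** On a finite list a strict threshold is also a non-strict one, so counts of entries >= g
    determine multiplicities. *)
Lemma next_value (u : seq R) (g : R) :
  exists2 g', g < g' & forall x, x \in u -> (g < x) = (g' <= x).
Proof.
elim: u => [|y u [g' gg' g'E]]; first by exists (g + 1); rewrite ?ltrDl.
have [gy|yg] := ltP g y; last first.
  exists g' => // x; rewrite inE => /predU1P[->|/g'E //].
  by rewrite ltNge yg leNgt (le_lt_trans yg gg').
exists (Num.min g' y) => [|x]; first by rewrite lt_min gg'.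
rewrite ge_min inE => /predU1P[->|xu]; first by rewrite gy lexx orbT.
rewrite -(g'E _ xu); case: (boolP (y <= x)) => yx; last by rewrite orbF.
by rewrite orbT (lt_le_trans gy).
Qed.

Lemma perm_eq_counts s t :
  (forall g, count (fun x => g <= x) s = count (fun x => g <= x) t) -> perm_eq s t.
Proof.
move=> cst; apply/allP => g _ /=; apply/eqP.
have [g' _ g'E] := next_value (s ++ t) g.
have split_count u : {subset u <= s ++ t} ->
    count (fun x => g <= x) u = (count_mem g u + count (fun x => (g' <= x)%R) u)%N.
  move=> ust; have <- : count (fun x => g < x) u = count (fun x => g' <= x) u.
    by apply: eq_in_count => x /ust /g'E.
  rewrite -count_predUI [X in (_ + X)%N](_ : _ = 0%N) ?addn0.
    by apply: eq_count => x /=; rewrite le_eqVlt eq_sym.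
  apply/eqP; rewrite -leqn0 leqNgt -has_count; apply/hasPn => x _ /=.
  by apply/negP => /andP[/eqP->]; rewrite ltxx.
have := cst g; rewrite !split_count ?cst => [/addIn //||];
  by move=> x xs; rewrite mem_cat xs ?orbT.
Qed.

End Majorization.

(** * Bases compatible with an exact sequence *)

Section SplitBasis.
Variables (A : comNzRingType) (M1 M2 M3 : vectType A).
Variables (i : 'Hom(M1, M2)) (s : 'Hom(M2, M3)).
Hypotheses (iinj : injective i) (exM : forall y, s y = 0 <-> exists x, y = i x).
Variables (n1 n3 : nat) (e : 'I_n1 -> M1) (c1 : 'I_n1 -> M1 -> A).
Variables (b : 'I_n3 -> M3) (c3 : 'I_n3 -> M3 -> A) (bl : 'I_n3 -> M2).
Hypotheses (ec : is_basis e c1) (bc3 : is_basis b c3) (sbl : forall j, s (bl j) = b j).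

Definition ext_family (k : 'I_(n1 + n3)) : M2 :=
  match split k with inl j => i (e j) | inr j => bl j end.

Lemma ext_family_l j : ext_family (lshift n3 j) = i (e j).
Proof. by rewrite /ext_family (unsplitK (inl j)). Qed.

Lemma ext_family_r j : ext_family (rshift n1 j) = bl j.
Proof. by rewrite /ext_family (unsplitK (inr j)). Qed.

Lemma si0 x : s (i x) = 0.
Proof. by apply/exM; exists x. Qed.

Lemma ext_family_sum (a : 'I_(n1 + n3) -> A) :
  \sum_k a k *: ext_family k =
  i (\sum_j a (lshift n3 j) *: e j) + \sum_j a (rshift n1 j) *: bl j.
Proof.
rewrite big_split_ord /=; congr (_ + _).
  by rewrite linear_sum; apply: eq_bigr => j _; rewrite ext_family_l linearZ.
by apply: eq_bigr => j _; rewrite ext_family_r.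
Qed.

Lemma s_lincomb_lift (a : 'I_n3 -> A) : s (\sum_j a j *: bl j) = \sum_j a j *: b j.
Proof. by rewrite linear_sum; apply: eq_bigr => j _; rewrite linearZ /= sbl. Qed.

Lemma ext_basis : exists cE, [/\ is_basis ext_family cE,
    forall j x, cE (lshift n3 j) (i x) = c1 j x
  & forall j y, cE (rshift n1 j) y = c3 j (s y)].
Proof.
have [cE EcE] : exists cE, is_basis ext_family cE.
  apply: is_basis_of_free => [x|a].
    have : s (x - \sum_j c3 j (s x) *: bl j) = 0.
      rewrite linearB /= s_lincomb_lift; case: bc3 => _ <- _; exact: subrr.
    move=> /exM[u xE].
    exists (fun k => match split k with inl j => c1 j u | inr j => c3 j (s x) end).
    rewrite ext_family_sum.
    under eq_bigr => j _ do rewrite (unsplitK (inl j)).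
    under [X in _ + X]eq_bigr => j _ do rewrite (unsplitK (inr j)).
    by case: ec => _ <- _; rewrite -xE subrK.
  rewrite ext_family_sum => a0.
  have ar j : a (rshift n1 j) = 0.
    have := congr1 s a0; rewrite linearD /= si0 add0r s_lincomb_lift linear0.
    by move/(congr1 (c3 j)); rewrite (basis_coord_sum bc3) (basis_coord0 bc3).
  have al j : a (lshift n3 j) = 0.
    move: a0; rewrite [X in _ + X]big1 => [|l _]; last by rewrite ar scale0r.
    rewrite addr0 -(linear0 i) => /iinj /(congr1 (c1 j)).
    by rewrite (basis_coord_sum ec) (basis_coord0 ec).
  by move=> k; rewrite -(splitK k); case: (split k).
exists cE; split=> // [j x|j y].
  have [_ /(_ x) {1}-> _] := ec; rewrite linear_sum /= (basis_coord_big EcE).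
  rewrite (bigD1 j) //= big1 => [|l lj].
    rewrite linearZ /= (basis_coordZ EcE) -ext_family_l.
    by case: EcE => _ _ ->; rewrite eqxx mulr1 addr0.
  rewrite linearZ /= (basis_coordZ EcE) -ext_family_l; case: EcE => _ _ ->.
  by rewrite (inj_eq (@lshift_inj _ _)) eq_sym (negPf lj) mulr0.
have [_ /(_ y) {2}-> _] := EcE; rewrite ext_family_sum linearD /= si0 add0r s_lincomb_lift.
by rewrite (basis_coord_sum bc3).
Qed.

End SplitBasis.

Lemma bc_fun_hom (A S : comNzRingType) (f : {rmorphism A -> S}) (N P : vectType A)
    (h : 'Hom(N, P)) (I : finType) (e : I -> P) (d : I -> P -> A) (d' : N -> A) j u :
  is_basis e d -> (forall x, d' x = d j (h x)) ->
  bc_fun (f := f) (d j) (bc_hom f h u) = bc_fun (f := f) d' u.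
Proof.
move=> ed dE; rewrite [in LHS](bc_sum u) linear_sum (basis_coord_big (bc_basis f ed)).
apply: eq_bigr => l _.
by rewrite linearZ /= (basis_coordZ (bc_basis f ed)) bc_homE (bc_fun_in f ed) dE.
Qed.

Lemma det_row_replaced (A : comNzRingType) n (d w : 'I_n -> A) (i0 : 'I_n) :
  \det (\matrix_(k, l) (if k == i0 then w l else (k == l)%:R * d k)) =
  w i0 * \prod_(k | k != i0) d k.
Proof.
rewrite /determinant (bigD1 1%g) //= [X in _ + X]big1 => [|s s1]; last first.
  (* A permutation fixing every index but i0 also fixes i0; so a nontrivial one moves some other k,
     whose row is diagonal, and its term vanishes. *)
  have [k ki sk] : exists2 k, k != i0 & s k != k.
    apply/exists_inP; rewrite -[X in is_true X]negbK negb_exists_in; apply: contra s1.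
    move=> /forall_inP h; apply/eqP/permP => k; rewrite perm1.
    have fix_ne l : l != i0 -> s l = l by move=> /h /negPn/eqP.
    have [->|/fix_ne //] := eqVneq k i0.
    apply/eqP; apply: contraT => si0; have := fix_ne _ si0.
    by move/perm_inj => si0'; rewrite si0' eqxx in si0.
  rewrite (bigD1 k) //= !mxE (negPf ki) eq_sym (negPf sk) !mul0r mulr0 //.
rewrite odd_perm1 expr0 mul1r addr0 (bigD1 i0) //= !mxE perm1 eqxx; congr (_ * _).
by apply: eq_bigr => k ki; rewrite !mxE perm1 (negPf ki) eqxx mul1r.
Qed.

(** * Determinants of families of vectors *)

Section CoordMatrix.
Variables (R : realType) (L : fieldType) (v : absval R L) (M : vectType (vring v)).
Local Notation incl := (@vr_val R L v : {rmorphism vring v -> L}).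
Local Notation V := (bc incl M).

Definition coord_mx n (c : 'I_n -> M -> vring v) (u : 'I_n -> V) : 'M[L]_n :=
  \matrix_(k, l) bc_fun (f := incl) (c l) (u k).

(** The change of basis has entries in the valuation ring, so its determinant has absolute value at
    most 1. By symmetry of the hypotheses |det| is independent of the basis. *)
Lemma abs_det_coord_mx n (e g : 'I_n -> M) c d (u : 'I_n -> V) :
  is_basis e c -> is_basis g d ->
  v (\det (coord_mx c u)) <= v (\det (coord_mx d u)).
Proof.
move=> ec gd.
have -> : coord_mx c u = coord_mx d u *m \matrix_(k, l) incl (c l (g k)).
  apply/matrixP => k l; rewrite !mxE.
  have [_ /(_ (u k)) {1}-> _] := bc_basis incl gd.
  rewrite (basis_coord_big (bc_basis incl ec)); apply: eq_bigr => j _.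
  by rewrite (basis_coordZ (bc_basis incl ec)) (bc_fun_in incl ec) !mxE.
rewrite det_mulmx absM ler_piMr ?abs_ge0 //.
rewrite -[leRHS](big1_eq (op := *%R) (index_enum 'I_n) predT).
by apply: abs_det_le => k l; rewrite mxE vring_le1.
Qed.

End CoordMatrix.

(** * Covolumes in an exact sequence *)

Section Exact.
Variables (R : realType) (p : nat) (E : padic_field R p).
Variables (K : perfectoid_ext E) (T : tilt K).

Local Notation O := (vring (tl_abs T)).
Local Notation absT := (tl_abs T).
Local Notation phi := (@tl_frob R p E K T : {rmorphism O -> O}).
Local Notation incl := (@vr_val R T (tl_abs T) : {rmorphism O -> T}).

Variables (M1 M2 M3 : phi_mod T) (i : 'Hom(M1, M2)) (s : 'Hom(M2, M3)).
Hypotheses (iphi : phi_morphism i) (sphi : phi_morphism s).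
Variables (n1 n3 : nat).
Variables (e : 'I_n1 -> M1) (c1 : 'I_n1 -> M1 -> O) (x : 'I_n1 -> T).
Variables (b : 'I_n3 -> M3) (c3 : 'I_n3 -> M3 -> O) (y : 'I_n3 -> T).
Variables (w : 'I_n3 -> bc phi M3) (d : 'I_n3 -> bc phi M3 -> O).
Variables (g : 'I_(n1 + n3) -> M2) (cG : 'I_(n1 + n3) -> M2 -> O) (z : 'I_(n1 + n3) -> T).
Variables (bl : 'I_n3 -> M2) (wl : 'I_n3 -> bc phi M2).
Variable cE : 'I_(n1 + n3) -> M2 -> O.
Hypotheses (ad1 : adapted e c1 x) (ad3 : adapted b c3 y) (ad2 : adapted g cG z).
Hypotheses (wd : is_basis w d).
Hypothesis wb : forall j, pm_phi M3 (bc_in incl (w j)) = y j *: bc_in incl (b j).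
Hypothesis sbl : forall j, s (bl j) = b j.
Hypothesis swl : forall j, bc_hom phi s (wl j) = w j.
Hypothesis si0 : forall u, s (i u) = 0.
Hypothesis EcE : is_basis (ext_family i e bl) cE.
Hypothesis cEl : forall j u, cE (lshift n3 j) (i u) = c1 j u.
Hypothesis cEr : forall j u, cE (rshift n1 j) u = c3 j (s u).

Let ec : is_basis e c1. Proof. by case: ad1. Qed.
Let bc3 : is_basis b c3. Proof. by case: ad3. Qed.
Let gcG : is_basis g cG. Proof. by case: ad2. Qed.
Let x0 : forall j, x j != 0. Proof. by case: ad1. Qed.
Let y0 : forall j, y j != 0. Proof. by case: ad3. Qed.
Let z0 : forall j, z j != 0. Proof. by case: ad2. Qed.

Local Notation EC k := (bc_fun (f := incl) (cE k)).
Local Notation GC k := (bc_fun (f := incl) (cG k)).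

(** Dividing it by y_j gives a lift of b_j coming from M2', while [bl j] is one in M2. The defect
    between these two lifts is what has to be controlled. *)
Let lift_frob j := pm_phi M2 (bc_in incl (wl j)).

Lemma bc_hom_si (S : comNzRingType) (f : {rmorphism O -> S}) u :
  bc_hom f s (bc_hom f i u) = 0.
Proof.
rewrite (bc_sum u) !linear_sum big1 // => j _.
by rewrite !linearZ /= !bc_homE si0 bc_in0 scaler0.
Qed.

Lemma ext_coord_r (S : comNzRingType) (f : {rmorphism O -> S}) j u :
  bc_fun (f := f) (cE (rshift n1 j)) u = bc_fun (f := f) (c3 j) (bc_hom f s u).
Proof. by rewrite (bc_fun_hom _ bc3 (cEr j)). Qed.

Lemma ext_coord_l (S : comNzRingType) (f : {rmorphism O -> S}) j u :
  bc_fun (f := f) (cE (lshift n3 j)) (bc_hom f i u) = bc_fun (f := f) (c1 j) u.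
Proof. by rewrite (bc_fun_hom _ EcE (fun u => esym (cEl j u))). Qed.

Lemma sub_frob_image (u : bc phi M1) :
  bc_hom incl i (pm_phi M1 (bc_in incl u)) = pm_phi M2 (bc_in incl (bc_hom phi i u)).
Proof. by rewrite iphi bc_homE. Qed.

Lemma quot_lift_frob j : bc_hom incl s (lift_frob j) = y j *: bc_in incl (b j).
Proof. by rewrite /lift_frob sphi bc_homE swl wb. Qed.

Lemma frob_image_coord l (u : bc phi M2) :
  absT (GC l (pm_phi M2 (bc_in incl u))) <= absT (z l).
Proof.
have [_ _ _ /(_ u)[D ->]] := ad2; rewrite (basis_coord_sum (bc_basis incl gcG)).
by rewrite absM ler_piMl ?abs_ge0 // vring_le1.
Qed.

Lemma integral_coord l u : absT (GC l (bc_in incl u)) <= 1.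
Proof. by rewrite (bc_fun_in incl gcG) vring_le1. Qed.

Lemma sub_frob_mem j : exists u : bc phi M2,
  x j *: bc_in incl (i (e j)) = pm_phi M2 (bc_in incl u).
Proof.
have [_ _ /(_ j)[u uE] _] := ad1; exists (bc_hom phi i u).
by rewrite -sub_frob_image -uE linearZ /= bc_homE.
Qed.

(** The sequence of lattices M1', M2', M3' is exact too: subtracting the lifts [wl] leaves an
    element of phi^* M2 killed by s, which comes from phi^* M1 because the sequence splits. *)
Lemma frob_image_decomp (u : bc phi M2) : exists (D1 : 'I_n1 -> O) (D3 : 'I_n3 -> O),
  pm_phi M2 (bc_in incl u) =
    \sum_j (vr_val (D1 j) * x j) *: bc_in incl (i (e j)) +
    \sum_j vr_val (D3 j) *: lift_frob j.
Proof.
pose D3 j := d j (bc_hom phi s u); pose u' := u - \sum_j D3 j *: wl j.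
have su' : bc_hom phi s u' = 0.
  rewrite linearB linear_sum /=; under eq_bigr do rewrite linearZ /= swl.
  by case: wd => _ <- _; rewrite subrr.
pose u1 : bc phi M1 := \sum_j bc_fun (f := phi) (cE (lshift n3 j)) u' *: bc_in phi (e j).
have u'E : u' = bc_hom phi i u1.
  have [_ /(_ u') -> _] := bc_basis phi EcE; rewrite big_split_ord /=.
  rewrite [X in _ + X]big1 => [|j _]; last first.
    by rewrite ext_coord_r su' (basis_coord0 (bc_basis phi bc3)) scale0r.
  rewrite addr0 linear_sum; apply: eq_bigr => j _.
  by rewrite linearZ /= bc_homE ext_family_l.
have [_ _ _ /(_ u1)[D1 D1E]] := ad1; exists D1, D3.
have -> : u = u' + \sum_j D3 j *: wl j by rewrite subrK.
rewrite bc_inD linearD /= pm_phi_lincomb; congr (_ + _).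
rewrite u'E -sub_frob_image D1E linear_sum; apply: eq_bigr => j _.
by rewrite linearZ /= bc_homE.
Qed.

Definition flag (v1 : 'I_n1 -> bc incl M2) (v3 : 'I_n3 -> bc incl M2) (k : 'I_(n1 + n3)) :=
  match split k with inl j => v1 j | inr j => v3 j end.

Lemma flag_l v1 v3 j : flag v1 v3 (lshift n3 j) = v1 j.
Proof. by rewrite /flag (unsplitK (inl j)). Qed.

Lemma flag_r v1 v3 j : flag v1 v3 (rshift n1 j) = v3 j.
Proof. by rewrite /flag (unsplitK (inr j)). Qed.

(** The first vectors lie in the kernel of s, so the coordinate matrix is block triangular, with a
    diagonal block on the quotient. *)
Lemma det_flag v1 v3 (t : 'I_n3 -> T) :
  (forall j, bc_hom incl s (v1 j) = 0) ->
  (forall j, bc_hom incl s (v3 j) = t j *: bc_in incl (b j)) ->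
  \det (coord_mx cE (flag v1 v3)) =
    \det (\matrix_(k, l) EC (lshift n3 l) (v1 k)) * \prod_j t j.
Proof.
move=> sv1 sv3; rewrite -[coord_mx _ _]submxK.
have -> : ursubmx (coord_mx cE (flag v1 v3)) = 0.
  apply/matrixP => k l; rewrite !mxE flag_l ext_coord_r sv1.
  exact: basis_coord0 (bc_basis incl bc3) _.
have -> : drsubmx (coord_mx cE (flag v1 v3)) = diag_mx (\row_j t j).
  apply/matrixP => k l; rewrite !mxE flag_r ext_coord_r sv3.
  rewrite (basis_coordZ (bc_basis incl bc3)); case: (bc_basis incl bc3) => _ _ ->.
  by rewrite mulr_natr eq_sym.
rewrite det_lblock det_diag; congr (\det _ * _).
  by apply/matrixP => k l; rewrite !mxE flag_l.
by apply: eq_bigr => j _; rewrite mxE.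
Qed.

Lemma det_flag_diag (t1 : 'I_n1 -> T) v3 (t : 'I_n3 -> T) :
  (forall j, bc_hom incl s (v3 j) = t j *: bc_in incl (b j)) ->
  \det (coord_mx cE (flag (fun j => t1 j *: bc_in incl (i (e j))) v3)) =
    (\prod_j t1 j) * \prod_j t j.
Proof.
move=> sv3; rewrite (det_flag _ sv3) => [|j]; last first.
  by rewrite linearZ /= bc_homE si0 bc_in0 scaler0.
congr (_ * _); rewrite -[RHS](eq_bigr _ (fun j _ => mxE _ _ 0 j : (\row_j t1 j) 0 j = _)) -det_diag.
congr (\det _); apply/matrixP => k l; rewrite !mxE (basis_coordZ (bc_basis incl EcE)).
rewrite (bc_fun_in incl EcE) cEl; case: ec => _ _ ->.
by rewrite rmorph_nat mulr_natr eq_sym.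
Qed.

(** Both families [B] and z_k g_k generate M2', so their determinants differ by a unit. This gives
    the equality of total sums in the comparison of types. *)
Lemma abs_prod_exact :
  absT ((\prod_j x j) * \prod_j y j) = absT (\prod_k z k).
Proof.
pose B := flag (fun j => x j *: bc_in incl (i (e j))) lift_frob.
have detB : \det (coord_mx cE B) = (\prod_j x j) * \prod_j y j.
  exact: det_flag_diag quot_lift_frob.
apply/eqP; rewrite eq_le -detB; apply/andP; split.
  apply: le_trans (abs_det_coord_mx _ EcE gcG) _; rewrite abs_prod.
  apply: abs_det_le => k l; rewrite mxE -(splitK k); case: (split k) => j /=.
    by rewrite /B flag_l; have [u ->] := sub_frob_mem j; exact: frob_image_coord.
  by rewrite /B flag_r; exact: frob_image_coord.
pose Z k : bc incl M2 := z k *: bc_in incl (g k).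
have -> : \prod_k z k = \det (coord_mx cG Z).
  rewrite -[LHS](eq_bigr _ (fun j _ => mxE _ _ 0 j : (\row_j z j) 0 j = _)) -det_diag.
  congr (\det _); apply/matrixP => k l; rewrite !mxE (basis_coordZ (bc_basis incl gcG)).
  rewrite (bc_fun_in incl gcG); case: gcG => _ _ ->.
  by rewrite rmorph_nat mulr_natr eq_sym.
apply: le_trans (abs_det_coord_mx _ gcG EcE) _.
have ZD k : exists D : 'I_(n1 + n3) -> O, Z k = \sum_l vr_val (D l) *: B l.
  have [_ _ /(_ k)[u uE] _] := ad2; have [D1 [D3 D13]] := frob_image_decomp u.
  exists (fun l => match split l with inl j => D1 j | inr j => D3 j end).
  rewrite /Z uE D13 big_split_ord /=; congr (_ + _); apply: eq_bigr => j _.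
    by rewrite (unsplitK (inl j)) /B flag_l scalerA.
  by rewrite (unsplitK (inr j)) /B flag_r.
have [D DE] := choice ZD.
have -> : coord_mx cE Z = (\matrix_(k, l) incl (D k l)) *m coord_mx cE B.
  apply/matrixP => k l; rewrite !mxE DE (basis_coord_big (bc_basis incl EcE)).
  by apply: eq_bigr => j _; rewrite (basis_coordZ (bc_basis incl EcE)) !mxE.
rewrite det_mulmx absM ler_piMl ?abs_ge0 //.
rewrite -[leRHS](big1_eq (op := *%R) (index_enum 'I_(n1 + n3)) predT).
by apply: abs_det_le => k l; rewrite mxE vring_le1.
Qed.

(** * The lattice M2 + a M2' *)

Section ScaledLattice.
Variable a : T.

(** A generator of the fractional ideal O + a t O, so that max(1, |a t|) is the absolute value of an
    actual scalar. *)
Let unit_or (t : T) : T := if absT (a * t) <= 1 then 1 else a * t.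

Lemma abs_unit_or t : absT (unit_or t) = Num.max 1 (absT (a * t)).
Proof. by rewrite /unit_or; case: ltP; rewrite ?abs1 // leNgt => ->. Qed.

(** A lift of the generator of (O + a y_j O) b_j, taken in M2 or in a M2' according to which summand
    dominates. *)
Let row3 j := if absT (a * y j) <= 1 then bc_in incl (bl j) else a *: lift_frob j.

Lemma quot_row3 j : bc_hom incl s (row3 j) = unit_or (y j) *: bc_in incl (b j).
Proof.
rewrite /row3 /unit_or; case: ifP => _; first by rewrite bc_homE sbl scale1r.
by rewrite linearZ /= quot_lift_frob scalerA.
Qed.

(* The lattice M2 + a M2', in coordinates. *)
Definition in_sum_lattice (v : bc incl M2) :=
  forall l, absT (GC l v) <= Num.max 1 (absT (a * z l)).

Lemma integral_in_sum u : in_sum_lattice (bc_in incl u).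
Proof. by move=> l; rewrite le_max integral_coord. Qed.

Lemma frob_in_sum u : in_sum_lattice (a *: pm_phi M2 (bc_in incl u)).
Proof.
move=> l; rewrite le_max (basis_coordZ (bc_basis incl gcG)) !absM.
by rewrite ler_wpM2l ?abs_ge0 ?frob_image_coord ?orbT.
Qed.

Lemma row1_in_sum j : in_sum_lattice (unit_or (x j) *: bc_in incl (i (e j))).
Proof.
rewrite /unit_or; case: ifP => _; first by rewrite scale1r; exact: integral_in_sum.
by rewrite -scalerA; have [u ->] := sub_frob_mem j; exact: frob_in_sum.
Qed.

Lemma row3_in_sum j : in_sum_lattice (row3 j).
Proof.
by rewrite /row3; case: ifP => _; [exact: integral_in_sum|exact: frob_in_sum].
Qed.

Lemma abs_det_in_sum (u : 'I_(n1 + n3) -> bc incl M2) :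
  (forall k, in_sum_lattice (u k)) ->
  absT (\det (coord_mx cE u)) <= \prod_l Num.max 1 (absT (a * z l)).
Proof.
move=> us; apply: le_trans (abs_det_coord_mx _ EcE gcG) _.
by apply: abs_det_le => k l; rewrite mxE; exact: us.
Qed.

Lemma prod_max_le :
  (\prod_j Num.max 1 (absT (a * x j))) * (\prod_j Num.max 1 (absT (a * y j))) <=
  \prod_l Num.max 1 (absT (a * z l)).
Proof.
under eq_bigr do rewrite -abs_unit_or; under [X in _ * X]eq_bigr do rewrite -abs_unit_or.
rewrite -!abs_prod -absM -(det_flag_diag _ quot_row3); apply: abs_det_in_sum => k.
rewrite -(splitK k); case: (split k) => j /=; rewrite ?flag_l ?flag_r.
  exact: row1_in_sum.
exact: row3_in_sum.
Qed.

(* Equality says that the flag of [prod_max_le] is a basis of M2 + a M2'; by Cramer's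
   rule the intersection of that lattice with M1 (x) K^flat is M1 + a M1'. *)
Lemma prod_max_eq_coord v j :
  (\prod_j Num.max 1 (absT (a * x j))) * (\prod_j Num.max 1 (absT (a * y j))) =
  \prod_l Num.max 1 (absT (a * z l)) ->
  in_sum_lattice v -> bc_hom incl s v = 0 ->
  absT (EC (lshift n3 j) v) <= Num.max 1 (absT (a * x j)).
Proof.
move=> eq_prod vL sv.
(* Replacing row j of the flag by v keeps all rows in the lattice. The determinant bound, divided by
   the unchanged diagonal factors, bounds coordinate j of v. *)
pose row1 k := if k == j then v else unit_or (x k) *: bc_in incl (i (e k)).
have srow1 k : bc_hom incl s (row1 k) = 0.
  rewrite /row1; case: eqP => // _.
  by rewrite linearZ /= bc_homE si0 bc_in0 scaler0.
have row1E : \matrix_(k, l) EC (lshift n3 l) (row1 k) =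
    \matrix_(k, l) (if k == j then EC (lshift n3 l) v else (k == l)%:R * unit_or (x k)).
  apply/matrixP => k l; rewrite !mxE /row1; case: ifP => // _.
  rewrite (basis_coordZ (bc_basis incl EcE)) (bc_fun_in incl EcE) cEl.
  by case: ec => _ _ ->; rewrite rmorph_nat eq_sym mulrC.
have := @abs_det_in_sum (flag row1 row3).
rewrite (det_flag srow1 quot_row3) row1E det_row_replaced -eq_prod => h.
have {h} : absT (EC (lshift n3 j) v * \prod_(k | k != j) unit_or (x k) *
      \prod_j0 unit_or (y j0)) <=
    (\prod_j0 Num.max 1 (absT (a * x j0))) * (\prod_j0 Num.max 1 (absT (a * y j0))).
  apply: h => k; rewrite -(splitK k); case: (split k) => l /=; rewrite ?flag_l ?flag_r.
    by rewrite /row1; case: eqP => // _; exact: row1_in_sum.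
  exact: row3_in_sum.
have max_gt0 (t : T) : 0 < Num.max 1 (absT (a * t)) by rewrite lt_max ltr01.
have prodE n (t : 'I_n -> T) P : absT (\prod_(k | P k) unit_or (t k)) =
    \prod_(k | P k) Num.max 1 (absT (a * t k)).
  by rewrite abs_prod; apply: eq_bigr => k _; exact: abs_unit_or.
rewrite [in leRHS](bigD1 j) // (absM absT (EC _ _ * _)) (absM absT (EC _ _)) !prodE.
rewrite -!mulrA ler_pM2r //.
by rewrite mulr_gt0 // prodr_gt0.
Qed.

End ScaledLattice.

Let lx := codom (fun j => log_abs (x j)).
Let ly := codom (fun j => log_abs (y j)).
Let lz := codom (fun j => log_abs (z j)).

Lemma abs_mul_log (a t : T) : t != 0 -> absT (a * t) = absT a * (pf_q E)%:R `^ log_abs t.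
Proof. by move=> t0; rewrite absM (log_absK t0). Qed.

Lemma prod_max_of_perm a : perm_eq (lx ++ ly) lz ->
  (\prod_j Num.max 1 (absT (a * x j))) * (\prod_j Num.max 1 (absT (a * y j))) =
  \prod_l Num.max 1 (absT (a * z l)).
Proof.
pose h t : R := Num.max 1 (absT a * (pf_q E)%:R `^ t).
have hE n (t : 'I_n -> T) : (forall j, t j != 0) ->
    \prod_j Num.max 1 (absT (a * t j)) = \prod_(r <- codom (fun j => log_abs (t j))) h r.
  by move=> t0; rewrite big_image; apply: eq_bigr => j _; rewrite abs_mul_log.
by move=> pxy; rewrite !hE // -big_cat; apply: perm_big.
Qed.

Lemma type_le_exact :
  type_le (sort (fun r r' => r' <= r) (lx ++ ly)) (sort (fun r r' => r' <= r) lz).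
Proof.
have tot : total (fun r r' : R => r' <= r) by move=> r r'; exact: le_total.
have perm_sum (h : R -> R) u :
    \sum_(r <- sort (fun r r' => r' <= r) u) h r = \sum_(r <- u) h r.
  by apply: perm_big; rewrite perm_sort.
have sumE n (t : 'I_n -> T) (h : R -> R) :
    \sum_(r <- codom (fun j => log_abs (t j))) h r = \sum_j h (log_abs (t j)).
  by rewrite big_image.
apply: type_le_of_excess => [|||c].
- by rewrite !size_sort size_cat !size_codom !card_ord.
- exact: sort_sorted.
- rewrite !perm_sum big_cat /= !(sumE _ _ id) -!log_abs_prod // -log_absM.
  + by rewrite /log_abs abs_prod_exact.
  + by apply/prodf_neq0.
  + by apply/prodf_neq0.
(* The threshold is an entry of the type of M2, hence in the value group: c = log_q |z_l|
   corresponds to the scalar a = z_l^-1, and q to the power of an excess is a product of max(1, |a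
   t_j|). *)
rewrite mem_sort => /codomP[l ->]; rewrite !perm_sum big_cat /= !sumE.
set c0 := log_abs (z l).
have maxE n (t : 'I_n -> T) : (forall j, t j != 0) ->
    (pf_q E)%:R `^ (\sum_j Num.max 0 (log_abs (t j) - c0)) =
    \prod_j Num.max 1 (absT ((z l)^-1 * t j)) :> R.
  have q0 : (pf_q E)%:R != 0 :> R by rewrite gt_eqF // (lt_trans ltr01 (pf_q_gt1 E)).
  move=> t0; elim/big_rec2: _ => [|j r r' _ <-]; first by rewrite powRr0.
  rewrite powRD ?q0 ?implybT //; congr (_ * _).
  rewrite log_absK ?mulf_neq0 ?invr_eq0 // log_absM ?invr_eq0 // log_absV // addrC.
  rewrite -[X in _ = Num.max X _](powRr0 (pf_q E)%:R).
  by case: (leP 0 (- c0 + log_abs (t j))) => h; [rewrite max_r|rewrite max_l];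
    rewrite ?ler_pf_q_powR // ltW.
rewrite -(ler_pf_q_powR E) powRD ?maxE //; first exact: prod_max_le.
by apply/implyP => _; rewrite gt_eqF // (lt_trans ltr01 (pf_q_gt1 E)).
Qed.

(** * Equality of types and exactness of Hodge filtrations *)

Section HodgeExact.
Variable F : residue_field (tl_abs T).
Local Notation res := (rf_map F).

Lemma dim_hodge g0 : perm_eq (lx ++ ly) lz ->
  (\dim (hodge F M1 g0) + \dim (hodge F M3 g0))%N = \dim (hodge F M2 g0).
Proof.
move=> /seq.permP pxy.
rewrite (hodge_adapted F g0 ad1) (hodge_adapted F g0 ad2) (hodge_adapted F g0 ad3).
rewrite (dim_coord_fil (bc_basis res ec)) (dim_coord_fil (bc_basis res bc3)).
by rewrite (dim_coord_fil (bc_basis res gcG)) -pxy count_cat.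
Qed.

Lemma perm_of_dim_hodge :
  (forall g0, \dim (hodge F M1 g0) + \dim (hodge F M3 g0) = \dim (hodge F M2 g0))%N ->
  perm_eq (lx ++ ly) lz.
Proof.
move=> dimE; apply: perm_eq_counts => g0; have := dimE g0.
rewrite (hodge_adapted F g0 ad1) (hodge_adapted F g0 ad2) (hodge_adapted F g0 ad3).
rewrite (dim_coord_fil (bc_basis res ec)) (dim_coord_fil (bc_basis res bc3)).
by rewrite (dim_coord_fil (bc_basis res gcG)) count_cat.
Qed.

(** The coordinates of the defect [v0] in M1 (x) K^flat are bounded by max(1, |a x_l|). Those of
    absolute value at most 1 correct the lift in M2; the others are at most |a x_l| and are absorbed
    by a M2'. *)
Lemma hodge_lift j g0 : perm_eq (lx ++ ly) lz -> g0 <= log_abs (y j) ->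
  bc_in res (b j) \in (bc_hom res s @: hodge F M2 g0)%VS.
Proof.
(* The scalar for which a * [lift_frob j] lifts b_j; the degree bound puts it in I(g0). *)
move=> pxy gj; pose a := (y j)^-1.
have a_le : absT a <= (pf_q E)%:R `^ (- g0).
  by rewrite log_absK ?invr_eq0 // log_absV // ler_pf_q_powR lerN2.
pose v0 := a *: lift_frob j - bc_in incl (bl j).
have sv0 : bc_hom incl s v0 = 0.
  by rewrite linearB linearZ /= quot_lift_frob bc_homE sbl scalerA mulVf // scale1r subrr.
have v0L : in_sum_lattice a v0.
  move=> l; rewrite (basis_coordB (bc_basis incl gcG)) abs_le_max ?absN //.
    exact: frob_in_sum.
  exact: integral_in_sum.
pose o l := EC (lshift n3 l) v0.
have o_le l : absT (o l) <= Num.max 1 (absT (a * x l)).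
  exact: prod_max_eq_coord (prod_max_of_perm a pxy) v0L sv0.
have v0E : v0 = \sum_l o l *: bc_in incl (i (e l)).
  have [_ /(_ v0) {1}-> _] := bc_basis incl EcE; rewrite big_split_ord /=.
  rewrite [X in _ + X]big1 => [|l _]; last first.
    by rewrite ext_coord_r sv0 (basis_coord0 (bc_basis incl bc3)) scale0r.
  by rewrite addr0; apply: eq_bigr => l _; rewrite ext_family_l.
pose small l := absT (o l) <= 1.
pose u := \sum_(l | small l) to_vring absT (o l) *: e l.
have suE : s (bl j + i u) = b j by rewrite linearD /= sbl si0 addr0.
have -> : bc_in res (b j) = bc_hom res s (bc_in res (bl j + i u)) by rewrite bc_homE suE.
apply: memv_img; apply: mem_span_set; exists (bl j + i u) => //.
(* Index 0 carries a * [lift_frob j]. The others write the large part of -[v0] on the vectors x_l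
   i(e_l) of M2', with coefficients of absolute value at most |a|. *)
pose co (k : 'I_n1.+1) : T :=
  if unlift ord0 k is Some l then (if small l then 0 else - (o l / x l)) else a.
pose vec (k : 'I_n1.+1) : bc incl M2 :=
  if unlift ord0 k is Some l then x l *: bc_in incl (i (e l)) else lift_frob j.
exists n1.+1, co, vec; split=> [k|k|].
- rewrite /co; case: unliftP => [l _|_] //; case: ifP => [_|]; first by rewrite abs0 powR_ge0.
  move=> /negbT; rewrite /small -ltNge => o1; apply: le_trans a_le.
  rewrite absN absM absV ler_pdivrMr ?abs_gt0 // -absM.
  by have := o_le l; rewrite le_max leNgt o1.
- rewrite /vec; case: unliftP => [l _|_]; last by exists (wl j).
  exact: sub_frob_mem.
rewrite big_ord_recl /co /vec unlift_none.
under eq_bigr do rewrite liftK.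
have -> : bc_in incl (bl j + i u) = a *: lift_frob j - v0 + bc_in incl (i u).
  by rewrite bc_inD /v0 subKr.
have -> : bc_in incl (i u) = \sum_l (if small l then o l else 0) *: bc_in incl (i (e l)).
  rewrite /u linear_sum bc_in_sum big_mkcond /=; apply: eq_bigr => l _.
  by case: ifP => [ol|_]; rewrite ?scale0r // linearZ /= bc_inZ /= to_vringK.
rewrite -addrA; congr (_ + _); rewrite v0E -sumrN -big_split; apply: eq_bigr => l _ /=.
case: ifP => _; first by rewrite scale0r addNr.
by rewrite scale0r addr0 scalerA mulNr divfK // scaleNr.
Qed.

(** Injectivity survives reduction because the sequence splits on bases, and surjectivity is
    [hodge_lift]. In the middle one inclusion is functoriality and additivity of dimensions gives
    the other. *)
Lemma hodge_exact_of_perm g0 : perm_eq (lx ++ ly) lz -> hodge_exact F i s g0.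
Proof.
move=> pxy.
have ker_i (U : {vspace red F M1}) : (U :&: lker (bc_hom res i) = 0)%VS.
  apply/eqP; rewrite -subv0; apply/subvP => v; rewrite memv_cap memv_ker => /andP[_ /eqP iv].
  rewrite memv0; apply/eqP; apply: (basis_coord_inj (bc_basis res ec)) => j.
  by rewrite -ext_coord_l iv (basis_coord0 (bc_basis res EcE)) (basis_coord0 (bc_basis res ec)).
have surj : (bc_hom res s @: hodge F M2 g0 = hodge F M3 g0)%VS.
  apply/eqP; rewrite eqEsubv hodge_morphism //= (hodge_adapted F g0 ad3).
  apply/span_subvP => _ /mapP[j + ->]; rewrite mem_enum inE => gj.
  exact: hodge_lift.
split=> //; apply/eqP; rewrite eqEdim; apply/andP; split.
  apply/subvP => v vi; rewrite memv_cap (subvP (hodge_morphism F iphi g0)) // memv_ker.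
  by have /memv_imgP[u _ ->] := vi; rewrite bc_hom_si /=.
rewrite (limg_dim_eq (ker_i _)).
by rewrite -(leq_add2r (\dim (hodge F M3 g0))) dim_hodge // -surj limg_ker_dim.
Qed.

Lemma perm_of_hodge_exact : (forall g0, hodge_exact F i s g0) -> perm_eq (lx ++ ly) lz.
Proof.
move=> ex; apply: perm_of_dim_hodge => g0; have [i0 mid surj] := ex g0.
by rewrite -(limg_ker_dim (bc_hom res s) (hodge F M2 g0)) -mid surj (limg_dim_eq i0).
Qed.

End HodgeExact.

End Exact.

(** * Hodge types of exact sequences *)

Section HodgeType.
Variables (R : realType) (p : nat) (E : padic_field R p).
Variables (K : perfectoid_ext E) (T : tilt K) (F : residue_field (tl_abs T)).
Local Notation O := (vring (tl_abs T)).
Local Notation phi := (@tl_frob R p E K T : {rmorphism O -> O}).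
Local Notation incl := (@vr_val R T (tl_abs T) : {rmorphism O -> T}).
Local Notation res := (rf_map F).

Lemma hodge_type_adapted (M : phi_mod T) (I : finType) (e : I -> M) c x :
  adapted e c x ->
  hodge_type F M = sort (fun r r' => r' <= r) (codom (fun j => log_abs (x j))).
Proof.
move=> ad; rewrite /hodge_type (hodge_adapted_fun F ad).
by case: ad => ec _ _ _; apply: (fil_type_coord (bc_basis res ec)).
Qed.

Lemma hodge_type_exact (M1 M2 M3 : phi_mod T) (i : 'Hom(M1, M2)) (s : 'Hom(M2, M3)) :
  short_exact i s ->
  type_le (type_cat (hodge_type F M1) (hodge_type F M3)) (hodge_type F M2) /\
  (type_cat (hodge_type F M1) (hodge_type F M3) = hodge_type F M2 <->
   forall g : R, hodge_exact F i s g).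
Proof.
case=> iphi sphi iinj exM ssurj.
have [e [c1 [x [w1 [d1 [ad1 _ _]]]]]] := adapted_exists (erefl (dim M1)).
have [b [c3 [y [w [d [ad3 wd wb]]]]]] := adapted_exists (erefl (dim M3)).
have [ec _ _ _] := ad1; have [bc3 _ _ _] := ad3.
have [bl sbl] := choice (fun j => ssurj (b j)).
have [cE [EcE cEl cEr]] := ext_basis iinj exM ec bc3 sbl.
(* Ranks are compared after reduction to the residue field, where the number of basis vectors is a
   dimension. *)
have dimM2 : dim M2 = (dim M1 + dim M3)%N.
  rewrite -[RHS]card_ord -(dim_basis (bc_basis res EcE)).
  by rewrite (dim_basis (bc_basis_vb res M2)) card_ord.
have [g [cG [z [_ [_ [ad2 _ _]]]]]] := adapted_exists dimM2.
(* w_j is expanded on the vectors 1 (x) b_l, and each b_l is replaced by its lift. *)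
pose wl j : bc phi M2 := \sum_l bc_fun (f := phi) (c3 l) (w j) *: bc_in phi (bl l).
have swl j : bc_hom phi s (wl j) = w j.
  rewrite linear_sum; under eq_bigr do rewrite linearZ /= bc_homE sbl.
  by case: (bc_basis phi bc3) => _ <- _.
have si0 u : s (i u) = 0 by apply/exM; exists u.
rewrite !(hodge_type_adapted ad1, hodge_type_adapted ad2, hodge_type_adapted ad3).
have tot : total (fun r r' : R => r' <= r) by move=> r r'; exact: le_total.
have geT : transitive (fun r r' : R => r' <= r) by move=> r' r r'' h h'; exact: le_trans h.
have geA : antisymmetric (fun r r' : R => r' <= r) by move=> r r'; rewrite andbC => /le_anti.
have -> : forall t t', type_cat (sort (fun r r' => r' <= r) t) (sort (fun r r' => r' <= r) t') =
    sort (fun r r' : R => r' <= r) (t ++ t').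
  by move=> t t'; apply/perm_sortP => //; rewrite perm_cat // perm_sort.
split; first exact: (type_le_exact iphi sphi ad1 ad3 ad2 wd wb sbl swl si0 EcE cEl cEr).
split=> [/(perm_sortP tot geT geA) pxy g0|ex].
  exact: (hodge_exact_of_perm iphi sphi ad1 ad3 ad2 wb sbl swl si0 EcE cEl cEr).
by apply/(perm_sortP tot geT geA); exact: (perm_of_hodge_exact ad1 ad3 ad2 ex).
Qed.

End HodgeType.

Theorem proposition26 (R : realType) (p : nat) (E : padic_field R p)
    (K : perfectoid_ext E) (T : tilt K) (W : ramified_witt T)
    (hW : normalized W) (F : residue_field (tl_abs T)) :
  (* F_H is a functor to filtered F-vector spaces *)
  ((forall M : phi_mod T, is_filtration (hodge F M)) /\
   (forall (M N : phi_mod T) (f : 'Hom(M, N)), phi_morphism f ->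
      forall g, (bc_hom (rf_map F) f @: hodge F M g <= hodge F N g)%VS)) /\
  (* tensor products *)
  (forall (M1 M2 N : phi_mod T) (b : {bilinear M1 -> M2 -> N}),
     phi_tensor b ->
     forall g, hodge F N g =
       fil_tensor (bc_bil (f := rf_map F) b) (hodge F M1) (hodge F M2) g) /\
  (* duals *)
  (forall (M D : phi_mod T) (ev : {bilinear D -> M -> (vring (tl_abs T))^o}),
     phi_dual ev ->
     forall g (d : red F D),
       d \in hodge F D g <->
       forall x : red F M, x \in fil_gt (hodge F M) (- g) ->
         bc_form (f := rf_map F) ev d x = 0) /\
  (* symmetric powers *)
  (forall (k : nat) (M N : phi_mod T) (m : {ffun 'I_k -> M} -> N),
     phi_sym_power m ->
     forall g, hodge F N g =
       fil_power (bc_mul (f := rf_map F) m) (hodge F M) g) /\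
  (* exterior powers *)
  (forall (k : nat) (M N : phi_mod T) (m : {ffun 'I_k -> M} -> N),
     phi_ext_power m ->
     forall g, hodge F N g =
       fil_power (bc_mul (f := rf_map F) m) (hodge F M) g) /\
  (* exact sequences *)
  (forall (M1 M2 M3 : phi_mod T) (i : 'Hom(M1, M2)) (s : 'Hom(M2, M3)),
     short_exact i s ->
     type_le (type_cat (hodge_type F M1) (hodge_type F M3)) (hodge_type F M2) /\
     (type_cat (hodge_type F M1) (hodge_type F M3) = hodge_type F M2 <->
      forall g : R, hodge_exact F i s g)).
Proof.
split; first by split; [exact: hodge_filtration | exact: hodge_morphism].
split; first exact: hodge_tensor.
split; first exact: hodge_dual.
split; first exact: hodge_sym_power.
split; first exact: hodge_ext_power.
exact: hodge_type_exact.
Qed.
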